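(* Let $d\ge2$ be a constant and $\phi\ge1$. Starting with an arbitrary tour, the expected number of steps performed by 2-Opt on $\phi$-perturbed Euclidean instances with $n$ vertices is $O(n^7\cdot\log^2(n)\cdot\phi^3)$.
   Context: A $\phi$-perturbed Euclidean instance: vertices $v_1,\ldots,v_n$ are placed independently in $[0,1]^d$, vertex $v_i$ according to a density $f_i\colon[0,1]^d\to[0,\phi]$, with $L_2$ distances. 2-Opt repeatedly performs improving 2-changes (replace tour edges $\{u_1,u_2\},\{v_1,v_2\}$, with $u_1,u_2,v_1,v_2$ distinct and in this order along the tour, by $\{u_1,v_1\},\{u_2,v_2\}$, provided the tour length strictly decreases) until none exists; the bound holds for any initial tour and any choice of improving steps. $O$-notation hides constants depending on $d$. *)

(* Defs.v *)
From HB Require Import structures.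
From mathcomp Require Import all_boot all_order all_algebra.
From mathcomp Require Import all_classical all_reals all_analysis.

Set Implicit Arguments.
Unset Strict Implicit.
Unset Printing Implicit Defensive.

Import Order.TTheory GRing.Theory Num.Theory.
Import numFieldNormedType.Exports.

Local Open Scope classical_set_scope.
Local Open Scope ring_scope.

(* The product sigma-algebra on tuples over [measurableTypeR R] is the Borel
   sigma-algebra of R^d. *)
Notation Rpoint R d := (d.-tuple (measurableTypeR R)).

Section lebesgue_tuple.
Context {R : realType}.

Definition pcons d (z : measurableTypeR R * Rpoint R d) : Rpoint R d.+1 :=
  [tuple of z.1 :: z.2].

Lemma measurable_pcons d : measurable_fun [set: _] (@pcons d).
Proof. exact: measurable_cons. Qed.

Section lebesgue_cons.
Variables (d : nat) (mu : {sigma_finite_measure set (Rpoint R d) -> \bar R}).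

Definition lebesgue_cons : set (Rpoint R d.+1) -> \bar R :=
  pushforward (@lebesgue_measure R \x mu)%E (@pcons d).

Let lebesgue_cons0 : lebesgue_cons set0 = 0%E.
Proof. by rewrite /lebesgue_cons /pushforward preimage_set0 measure0. Qed.

Let lebesgue_cons_ge0 A : (0 <= lebesgue_cons A)%E.
Proof. exact: (measure_ge0 (@lebesgue_measure R \x mu)%E). Qed.

Let lebesgue_cons_sigma_additive : semi_sigma_additive lebesgue_cons.
Proof.
exact: (@measure_semi_sigma_additive _ _ _
  (measure_function_pushforward__canonical__measure_function_Measure
     (@lebesgue_measure R \x mu)%E (@measurable_pcons d))).
Qed.

HB.instance Definition _ := isMeasure.Build _ _ _ lebesgue_cons
  lebesgue_cons0 lebesgue_cons_ge0 lebesgue_cons_sigma_additive.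

Let lebesgue_cons_sigma_finite : sigma_finite [set: Rpoint R d.+1] lebesgue_cons.
Proof.
have /sigma_finiteP[F [TF ndF Foo]] := sigma_finiteT (@lebesgue_measure R).
have /sigma_finiteP[G [TG ndG Goo]] := sigma_finiteT mu.
pose uncons (t : Rpoint R d.+1) : measurableTypeR R * Rpoint R d :=
  (tnth t ord0, [tuple of behead t]).
have unconsK : cancel (@pcons d) uncons.
  by move=> [x t]; congr pair; apply/val_inj.
have muncons : measurable_fun [set: _] uncons.
  apply: measurable_fun_pair; first exact: measurable_tnth.
  exact: measurable_behead.
exists (fun k => uncons @^-1` (F k `*` G k)).
  rewrite -preimage_bigcup; apply/esym/seteqP; split => // t _.
  have [i _ Fi] : (\bigcup_i F i) (uncons t).1 by rewrite -TF.
  have [j _ Gj] : (\bigcup_i G i) (uncons t).2 by rewrite -TG.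
  exists (maxn i j) => //; split.
  - by move: Fi; exact/subsetPset/ndF/leq_maxl.
  - by move: Gj; exact/subsetPset/ndG/leq_maxr.
move=> k; have [mFk Fkoo] := Foo k; have [mGk Gkoo] := Goo k; split.
  by rewrite -[X in measurable X]setTI; apply: muncons => //; exact: measurableX.
rewrite /lebesgue_cons /pushforward -comp_preimage.
rewrite (_ : uncons \o _ = id) ?preimage_id; last exact/funext.
by rewrite product_measure1E// lte_mul_pinfty// ge0_fin_numE.
Qed.

HB.instance Definition _ := Measure_isSigmaFinite.Build _ _ _ lebesgue_cons
  lebesgue_cons_sigma_finite.

End lebesgue_cons.

(* d-dimensional Lebesgue measure on the Borel sets of R^d, as the iterated
   product of the one-dimensional one; R^0 carries the unit mass. *)
Fixpoint lebesgue_tuple d : {sigma_finite_measure set (Rpoint R d) -> \bar R} :=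
  if d is d'.+1 then lebesgue_cons (lebesgue_tuple d') else \d_[tuple].

End lebesgue_tuple.

Section two_opt.
Context {R : realType} {n d : nat}.

Definition dist2 (p q : Rpoint R d) : R :=
  Num.sqrt (\sum_(j < d) ((tnth p j : R) - tnth q j) ^+ 2).

(* A tour lists the n vertices in visiting order; it is read cyclically, so
   [next t u] is the vertex visited after u. *)
Record tour : Type := Tour {
  tour_tuple :> n.-tuple 'I_n;
  tour_uniq : uniq tour_tuple }.

Definition tour_edges (t : tour) : {set {set 'I_n}} :=
  [set [set u; next t u] | u : 'I_n]%SET.

Definition tour_length (x : 'I_n -> Rpoint R d) (t : tour) : R :=
  \sum_(u < n) dist2 (x u) (x (next t u)).

(* For distinct vertices with [next t u1 = u2] and [next t v1 = v2], the order
   along t is u1, u2, v1, v2.  As t' is constrained only through its set of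
   edges, nothing depends on the starting point or the orientation of its
   visiting order. *)
Definition two_change (t t' : tour) : bool :=
  [exists u1, exists u2, exists v1, exists v2,
    [&& uniq [:: u1; u2; v1; v2], next t u1 == u2, next t v1 == v2 &
        tour_edges t' ==
          tour_edges t :\: [set [set u1; u2]; [set v1; v2]]
            :|: [set [set u1; v1]; [set u2; v2]]]]%SET.

Definition improving (x : 'I_n -> Rpoint R d) : rel tour :=
  fun t t' => two_change t t' && (tour_length x t' < tour_length x t).

Definition locally_optimal (x : 'I_n -> Rpoint R d) (t : tour) : Prop :=
  forall t', ~~ improving x t t'.

(* r lists the tours visited after t, so the run performs [size r] steps. *)
Definition two_opt_run (x : 'I_n -> Rpoint R d) (t : tour) (r : seq tour) : Prop :=
  path (improving x) t r /\ locally_optimal x (last t r).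

(* Worst case over the initial tour and over all choices of improving steps. *)
Definition two_opt_steps (x : 'I_n -> Rpoint R d) : \bar R :=
  ereal_sup [set s | exists t r, two_opt_run x t r /\ s = (size r)%:R%:E].

End two_opt.

Section perturbed.
Context {R : realType} {n d : nat} {disp : measure_display}
  {Omega : measurableType disp} (P : probability Omega R).

Definition unit_cube : set (Rpoint R d) :=
  [set p | forall j, 0 <= (tnth p j : R) <= 1].

Definition mutually_independent (X : 'I_n -> {RV P >-> Rpoint R d}) : Prop :=
  forall (J : {set 'I_n}) (A : 'I_n -> set (Rpoint R d)),
    (forall i, measurable (A i)) ->
    P (\bigcap_(i in [set` J]) (X i @^-1` A i)) =
    (\prod_(i in J) P (X i @^-1` A i))%E.

Definition has_density (X : {RV P >-> Rpoint R d}) (f : Rpoint R d -> R) : Prop :=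
  forall A, measurable A ->
    distribution P X A =
    (\int[lebesgue_tuple d]_(p in A `&` unit_cube) (f p)%:E)%E.

(* The values of f i outside the unit cube are irrelevant. *)
Definition perturbed_instance (phi : R) (f : 'I_n -> Rpoint R d -> R)
    (X : 'I_n -> {RV P >-> Rpoint R d}) : Prop :=
  [/\ forall i, measurable_fun unit_cube (f i : _ -> measurableTypeR R),
      forall i p, unit_cube p -> 0 <= f i p <= phi,
      forall i, has_density (X i) (f i) &
      mutually_independent X].

End perturbed.

(* Main.v *)
(* A 2-change on u1, u2, v1, v2 gains F(u1) - F(v2), where
   F(x) = |x - u2| - |x - v1|.  Fix u2 and v1, let rho be their distance in the sup
   norm, and let h(x) be comparable to the distance of x to the line through them.
   Along every parallel of this line h is constant and F is monotone with slope at
   least a constant times rho h^2, so a level set of F of width eps meets the parallel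
   in length O(eps / (rho h^2)).  Of two points x, c with |F(x) - F(c)| <= eps let x be
   the one with larger h; for given x, the points c with h(c) <= h(x) have measure
   O(h(x)), which cancels one factor 1 / h.  Integrating min(1, eps / (rho h)) gives
   O(eps log(1/eps) / rho), and averaging over u2 removes 1 / rho at the cost of one
   more factor phi.  A run of m steps starts at length at most L = n sqrt(d), so for
   every t <= m some 2-change gains at most L / t.  Summing over the n^4 quadruples and
   over t <= n^n, which bounds the number of steps, gives n^5 phi^3 log(n^n)^2. *)

Require Import Defs.
From HB Require Import structures.
From mathcomp Require Import all_boot all_order all_algebra.
From mathcomp Require Import all_classical all_reals all_analysis.
From mathcomp Require Import measurable_realfun ring lra zify.

Set Implicit Arguments.
Unset Strict Implicit.
Unset Printing Implicit Defensive.

Import Order.TTheory GRing.Theory Num.Theory.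
Import numFieldNormedType.Exports.

Local Open Scope classical_set_scope.
Local Open Scope ring_scope.

(** * Measure and integration *)

Lemma measurable_preimageT {d1 d2 : measure_display} {T1 : measurableType d1}
    {T2 : measurableType d2} (f : T1 -> T2) (A : set T2) :
  measurable_fun setT f -> measurable A -> measurable (f @^-1` A).
Proof. by move=> mf mA; rewrite -[_ @^-1` _]setTI; exact: mf. Qed.

Section integral_monotonicity.
Local Open Scope ereal_scope.
Context {disp : measure_display} {T : measurableType disp} {R : realType}.
Implicit Types (mu : {measure set T -> \bar R}) (f g : T -> \bar R).

Import HBNNSimple.

(* Integrals of nonnegative functions are suprema over simple functions, hence
   monotone even for nonmeasurable integrands. *)
Lemma le_integral_ge0 mu f g : (forall x, 0 <= g x) ->
  (forall x, f x <= g x) -> \int[mu]_x f x <= \int[mu]_x g x.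
Proof.
move=> g0 fg; rewrite integralE.
apply: (@le_trans _ _ (\int[mu]_x (f^\+ x))).
  by rewrite -[leRHS]sube0 leeD2l// leeN2 integral_ge0.
rewrite !ge0_integralTE//; apply: ge_ereal_sup => _ [h /= hf <-].
apply: ereal_sup_ubound; exists h => // x; apply: (le_trans (hf x)).
by rewrite funeposE ge_max fg g0.
Qed.

Lemma ae_le_integral_ge0 mu f g : (forall x, 0 <= g x) ->
  measurable_fun setT g -> {ae mu, forall x, f x <= g x} ->
  \int[mu]_x f x <= \int[mu]_x g x.
Proof.
move=> g0 mg [N [mN muN fgN]].
have oo0 x : 0 <= (cst +oo \_ N) x :> \bar R.
  by apply: erestrict_ge0 => y _; exact: le0y.
apply: (@le_trans _ _ (\int[mu]_x (g x + (cst +oo \_ N) x))).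
  apply: le_integral_ge0 => x; first by rewrite adde_ge0.
  have [Nx|Nx] := pselect (N x).
    by rewrite patchE mem_set// addey ?leey// gt_eqF// (lt_le_trans _ (g0 x)).
  have fgx : f x <= g x by apply: contrapT => /fgN.
  by rewrite (le_trans fgx)// leeDl.
rewrite ge0_integralD//; last first.
  by apply/(measurable_restrictT _ _).1 => //; exact: measurable_cst.
by rewrite -integral_mkcond integral_cst// [X in _ * X]muN mule0 adde0.
Qed.

Lemma ae_integral_le_sum_measure (I : Type) (s : seq I) (Q : pred I)
    (A : I -> set T) mu f : (forall i, measurable (A i)) ->
  {ae mu, forall x, f x <= \sum_(i <- s | Q i) (\1_(A i) x)%:E} ->
  \int[mu]_x f x <= \sum_(i <- s | Q i) mu (A i).
Proof.
move=> mA fA; have mind i : measurable_fun setT (EFin \o \1_(A i) : T -> \bar R).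
  exact/measurable_EFinP/measurable_indic.
rewrite -big_filter.
apply: (@le_trans _ _
    (\int[mu]_x (\sum_(i <- [seq i <- s | Q i]) (EFin \o \1_(A i)) x))).
  apply: ae_le_integral_ge0.
  - by move=> x; rewrite sume_ge0// => i _; rewrite lee_fin.
  - by apply: emeasurable_sum => i; exact: mind.
  - by move: fA; apply: filterS => x; rewrite big_filter.
rewrite ge0_integral_sum// => [|i x _]; last by rewrite lee_fin.
by apply: lee_sum => i _; rewrite integral_indic// setIT.
Qed.

Lemma integral_le_mul_measure mu f (M : \bar R) (D : set T) : measurable D ->
  0 <= M -> (forall x, D x -> f x <= M) -> (forall x, ~ D x -> f x <= 0) ->
  \int[mu]_x f x <= M * mu D.
Proof.
move=> mD M0 fM fD; rewrite -integral_cst// [leRHS]integral_mkcond.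
apply: le_integral_ge0 => x; first exact: erestrict_ge0.
by rewrite patchE; case: ifPn => [/set_mem/fM|/negP Dx]//; apply: fD => /mem_set.
Qed.

Lemma integral_probability_le (P : probability T R) f (M : \bar R) :
  0 <= M -> (forall x, f x <= M) -> \int[P]_x f x <= M.
Proof.
move=> M0 fM; rewrite -[leRHS]mule1 -[X in _ * X](@probability_setT _ _ _ P).
by apply: integral_le_mul_measure => // x nTx; case: (nTx I).
Qed.

End integral_monotonicity.

Section layers.
Context {R : realType}.

Lemma le_mul_layer_count (w K : R) (J : nat) (y : \bar R) : 0 <= K ->
  1 <= K * J%:R -> (y <= 1)%E -> (0 < w -> (y <= (K / w)%:E)%E) ->
  (y <= (K * (1 + \sum_(0 <= j < J) (w <= (harmonic j : R))%R%:R))%:E)%E.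
Proof.
move=> K0 KJ y1 yw; set count := \sum_(_ <= _ < _) _.
have le_count k : (k <= J)%N -> (forall j, (j < k)%N -> w <= harmonic j) ->
    k%:R <= count.
  move=> kJ wk; rewrite /count (big_cat_nat _ (n := k))//=.
  rewrite -[leLHS]addr0 lerD//; last exact: sumr_ge0.
  rewrite big_nat (eq_bigr (fun=> 1)) => [|j /andP[_ jk]]; last by rewrite wk.
  by rewrite -big_nat sumr_const_nat subn0.
have le_full : J%:R <= count -> (y <= (K * (1 + count))%:E)%E.
  move=> Jcount; apply: (le_trans y1); rewrite lee_fin; apply: (le_trans KJ).
  by rewrite ler_wpM2l// (le_trans Jcount)// lerDr.
have [w0|w0] := leP w 0.
  by apply/le_full/le_count => // j _; exact: le_trans (harmonic_ge0 _).
have le_harmonic j : (j < Num.truncn w^-1)%N -> w <= harmonic j.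
  move=> jw; rewrite -[leLHS]invrK lef_pV2 ?posrE ?invr_gt0//.
  apply: (@le_trans _ _ (Num.truncn w^-1)%:R); first by rewrite ler_nat.
  by rewrite truncn_le invr_ge0 ltW.
have [Jw|wJ] := leqP J (Num.truncn w^-1).
  by apply/le_full/le_count => // j jJ; exact: le_harmonic (leq_trans jJ Jw).
apply: (le_trans (yw w0)); rewrite lee_fin ler_wpM2l// addrC.
apply: (le_trans (ltW (truncnS_gt _))); rewrite -natr1 lerD2r.
exact: le_count (ltnW wJ) _.
Qed.

(* [f] is bounded by min(1, K / w), hence by K plus K for each j <= J with
   w <= 1 / j. *)
Lemma integral_layer_le {disp : measure_display} {T : measurableType disp}
    (mu : {measure set T -> \bar R}) (D : set T) (w : T -> R) (f : T -> \bar R)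
    (K M : R) (J : nat) (m : nat -> R) :
  measurable D -> measurable_fun setT w -> 0 <= K -> 1 <= K * J%:R ->
  (forall x, ~ D x -> f x <= 0)%E -> (forall x, f x <= 1)%E ->
  (forall x, (0 < w x)%R -> f x <= (K / w x)%:E)%E ->
  (mu D <= M%:E)%E ->
  (forall j, (mu (D `&` [set x | (w x <= harmonic j)%R]) <= (m j)%:E)%E) ->
  (\int[mu]_x f x <= (K * (M + \sum_(0 <= j < J) m j))%:E)%E.
Proof.
move=> mD mw K0 KJ fD f1 fw muD mum.
pose layer j := D `&` [set x | w x <= harmonic j].
have mlayer j : measurable (layer j).
  by apply: measurable_fun_le => //; exact: measurable_funTS.
have mind (A : set T) : measurable A ->
    measurable_fun setT (EFin \o \1_A : T -> \bar R).
  by move=> mA; exact/measurable_EFinP/measurable_indic.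
have ind0 (A : set T) x : (0 <= (EFin \o \1_A) x :> \bar R)%E by rewrite lee_fin.
apply: (@le_trans _ _ (\int[mu]_x (K%:E * ((\1_D x)%:E +
    \sum_(0 <= j < J) (\1_(layer j) x)%:E)))%E).
  apply: le_integral_ge0 => x; first by rewrite mule_ge0 ?adde_ge0 ?sume_ge0.
  have [Dx|/fD fx0] := pselect (D x); last first.
    by apply: (le_trans fx0); rewrite mule_ge0 ?adde_ge0 ?sume_ge0.
  apply: (le_trans (le_mul_layer_count K0 KJ (f1 x) (fw x))).
  rewrite EFinM EFinD -sumEFin indicE mem_set// lee_wpmul2l// leeD2l//.
  apply: lee_sum => j _; rewrite indicE lee_fin.
  by have [wj|//] := boolP (w x <= _); rewrite mem_set.
have msum : measurable_fun setT
    (fun x => \sum_(0 <= j < J) (EFin \o \1_(layer j) : T -> \bar R) x)%E.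
  by apply: emeasurable_sum => j; exact: mind.
have sum0 x : (0 <= \sum_(0 <= j < J) (EFin \o \1_(layer j)) x :> \bar R)%E.
  by rewrite sume_ge0.
rewrite ge0_integralZl//; last 2 first.
- by apply: emeasurable_funD => //; exact: mind.
- by move=> x _; rewrite adde_ge0 ?sum0.
rewrite ge0_integralD//; last 2 first.
- exact: mind.
- by move=> x _; exact: sum0.
rewrite integral_indic// setIT ge0_integral_sum//; last by move=> j; exact: mind.
rewrite EFinM EFinD -sumEFin lee_wpmul2l ?lee_fin// leeD//.
by apply: lee_sum => j _; rewrite integral_indic// setIT; exact: mum.
Qed.

Lemma series_harmonic_ge0 J : 0 <= series harmonic J :> R.
Proof. by apply: sumr_ge0 => j _; exact: harmonic_ge0. Qed.

Lemma series_harmonic_le_ln J : (0 < J)%N -> series harmonic J <= 1 + ln J%:R :> R.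
Proof.
case: J => // J _; elim: J => [|J IH].
  by rewrite /series /= big_nat1 invr1 ln1 addr0.
rewrite seriesSr; apply: (le_trans (lerD IH (lexx _))).
rewrite -addrA lerD2l -lerBrDl -[leRHS]opprK opprB -ln_div ?posrE//.
have -> : J.+1%:R / J.+2%:R = 1 - harmonic J.+1 :> R.
  by rewrite -[J.+1%:R](addrK 1) natr1 mulrBl divff ?pnatr_eq0// div1r.
by rewrite lerNr le_ln1Dx// ltrN2 /= invf_lt1// ltr1n.
Qed.

Lemma series_inv_sqr_le2 J : series (fun j => (harmonic j : R) ^+ 2) J <= 2.
Proof.
pose inv_sqr := (fun j => (harmonic j : R) ^+ 2).
suff le_telescope : series inv_sqr J.+1 <= 2 - harmonic J.
  apply: (@le_trans _ _ (series inv_sqr J.+1)).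
    by rewrite seriesSr lerDl sqr_ge0.
  by rewrite (le_trans le_telescope)// gerDl oppr_le0 harmonic_ge0.
elim: J => [|J IH].
  by rewrite /series /= big_nat1 /inv_sqr /= invr1 expr1n; lra.
rewrite seriesSr; apply: (le_trans (lerD IH (lexx _))); rewrite /inv_sqr /=.
set h := J.+1%:R^-1; set h' := J.+2%:R^-1.
have h'h : h' <= h by rewrite lef_pV2 ?posrE// ler_nat.
have h'0 : 0 <= h' by rewrite invr_ge0.
have : h - h' = h * h'.
  have : J.+1%:R != 0 :> R /\ J.+2%:R != 0 :> R by rewrite !pnatr_eq0.
  rewrite /h /h' -[J.+2%:R]natr1; move: (J.+1%:R : R) => t [t0 t1].
  by field; rewrite t0 t1.
nra.
Qed.

End layers.

Section product_measures.
Local Open Scope ereal_scope.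
Context {d1 d2 : measure_display} {T1 : measurableType d1}
  {T2 : measurableType d2} {R : realType}.

Lemma product_measureC (m1 : {sigma_finite_measure set T1 -> \bar R})
    (m2 : {sigma_finite_measure set T2 -> \bar R}) (A : set (T1 * T2)) :
  measurable A -> (m1 \x m2) A = (m1 \x^ m2) A.
Proof.
by move: A; apply: product_measure_unique => //= *; rewrite product_measure2E.
Qed.

Lemma product_measure_le_fibers (m1 : {sigma_finite_measure set T1 -> \bar R})
    (m2 : {sigma_finite_measure set T2 -> \bar R}) (A : set (T1 * T2))
    (C : set T2) (M : \bar R) : measurable A -> measurable C -> 0 <= M ->
  (forall y, m1 (ysection A y) <= M) -> (forall z, A z -> C z.2) ->
  (m1 \x m2) A <= M * m2 C.
Proof.
move=> mA mC M0 AM AC; rewrite product_measureC//.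
apply: integral_le_mul_measure => // [y _|y Cy] /=; first exact: AM.
rewrite (_ : ysection A y = set0) ?measure0//.
by apply/seteqP; split => // x; rewrite /ysection/= inE => /AC.
Qed.

Lemma product_measure_le (m1 m1' : {sigma_finite_measure set T1 -> \bar R})
    (m2 m2' : {sigma_finite_measure set T2 -> \bar R}) (k : {nonneg R}) :
  (forall A, measurable A -> m1 A <= k%:num%:E * m1' A) ->
  (forall A, measurable A -> m2 A <= k%:num%:E * m2' A) ->
  forall A, measurable A -> (m1 \x m2) A <= (k%:num ^+ 2)%:E * (m1' \x m2') A.
Proof.
move=> m1k m2k A mA.
have mA2 : measurable_fun setT (m2' \o xsection A) by exact: measurable_fun_xsection.
apply: (@le_trans _ _ (\int[m1]_x (k%:num%:E * m2' (xsection A x)))).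
  apply: le_integral_ge0 => x; first by rewrite mule_ge0.
  exact/m2k/measurable_xsection.
rewrite ge0_integralZl// expr2 EFinM -muleA lee_wpmul2l//.
rewrite -(@ge0_integral_mscale _ _ _ _ setT _ k)//.
exact: ge0_le_measure_integral.
Qed.

End product_measures.

Lemma product_measure_swap {disp : measure_display} {T : measurableType disp}
    {R : realType} (m : {sigma_finite_measure set T -> \bar R}) (A : set (T * T)) :
  measurable A -> (m \x m)%E A^-1%relation = (m \x m)%E A.
Proof.
by move=> mA; rewrite [RHS]product_measureC//; exact: eq_integral.
Qed.

(** * Lebesgue measure on tuples *)

Section lebesgue_translation.
Context {R : realType}.
Local Notation mR := (measurableTypeR R).
Local Notation leb := (@lebesgue_measure R).
Local Open Scope ereal_scope.

Lemma ge0_integral_lebesgueD (h : mR -> \bar R) (c : R) :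
  measurable_fun setT h -> (forall x, 0 <= h x) ->
  \int[leb]_x h (x + c)%R = \int[leb]_x h x.
Proof.
move=> mh h0.
have mD : measurable_fun [set: mR] (fun x : mR => (x + c)%R : mR).
  by apply: measurable_funD.
pose leb' := measure_function_pushforward__canonical__measure_function_Measure
  leb mD.
rewrite [RHS](eq_measure_integral leb'); last first.
  move=> A mA _; apply: (@lebesgue_measure_unique R leb') => // _ [[a b]] _ <-.
  rewrite /leb' /= /pushforward.
  have -> : (fun x : mR => (x + c)%R) @^-1` `]a, b] = `](a - c)%R, (b - c)%R]%classic.
    by apply/seteqP; split => x /=; rewrite !in_itv/= ltrBlDr lerBrDr.
  rewrite !lebesgue_measure_itv/= !lte_fin ltrD2r.
  by case: ifP => // _; rewrite -!EFinB; congr EFin; ring.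
by rewrite /leb' ge0_integral_pushforward.
Qed.

Lemma lebesgue_measure_unit_itv : leb `[0%R, 1%R]%classic = 1.
Proof. by rewrite lebesgue_measure_itv/= lte_fin ltr01 sube0. Qed.

Lemma lebesgue_measure_le_diameter (E : set mR) (delta : R) : measurable E ->
  (0 <= delta)%R -> (forall s s', E s -> E s' -> (`|s - s'| <= delta)%R) ->
  leb E <= (2 * delta)%:E.
Proof.
move=> mE d0 diamE; have [->|/set0P[s0 Es0]] := eqVneq E set0.
  by rewrite measure0 lee_fin mulr_ge0.
apply: (@le_trans _ _ (leb `[(s0 - delta)%R, (s0 + delta)%R]%classic)).
  apply: le_measure; rewrite ?inE// => s Es /=.
  by rewrite in_itv/= -ler_distl diamE.
rewrite lebesgue_measure_itv/= lte_fin.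
by case: ifP => _; rewrite -?EFinB lee_fin; lra.
Qed.

Lemma ge0_integral_lebesgue_tupleS d (h : Rpoint R d.+1 -> \bar R) :
  measurable_fun setT h -> (forall p, 0 <= h p) ->
  \int[lebesgue_tuple d.+1]_p h p =
  \int[leb]_x \int[lebesgue_tuple d]_p h (pcons (x, p)).
Proof.
move=> mh h0.
rewrite [LHS](@ge0_integral_pushforward _ _ _ _ R _ (@measurable_pcons R d))//.
rewrite preimage_setT fubini_tonelli1//.
  by apply: measurableT_comp => //; exact: measurable_pcons.
by move=> z; exact: h0.
Qed.

Definition translate d (v : 'I_d -> R) (x : Rpoint R d) : Rpoint R d :=
  [tuple (tnth x i + v i)%R | i < d].

Lemma tnth_translate d (v : 'I_d -> R) x i :
  tnth (translate v x) i = (tnth x i + v i)%R.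
Proof. by rewrite tnth_mktuple. Qed.

Lemma translate_pcons d (v : 'I_d.+1 -> R) x p :
  translate v (pcons (x, p)) =
  pcons ((x + v ord0)%R, translate (v \o lift ord0) p).
Proof.
apply: eq_from_tnth => i; rewrite tnth_translate.
case: (unliftP ord0 i) => [j|] ->; first by rewrite !tnthS tnth_translate.
by rewrite !tnth0.
Qed.

Lemma measurable_translate (disp : measure_display) (T : measurableType disp) d
    (v : T -> 'I_d -> mR) (f : T -> Rpoint R d) :
  (forall i, measurable_fun setT (v^~ i)) -> measurable_fun setT f ->
  measurable_fun setT (fun x => translate (v x) (f x)).
Proof.
move=> mv mf; apply/measurable_fun_tnthP => i.
rewrite (_ : _ \o _ = fun x => (tnth (f x) i + v x i : R)%R); last first.
  by apply/funext => x /=; rewrite tnth_translate.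
apply: measurable_funD; last exact: mv.
exact: measurableT_comp (@measurable_tnth _ _ _ _) mf.
Qed.

Lemma ge0_integral_translate d (v : 'I_d -> R) (h : Rpoint R d -> \bar R) :
  measurable_fun setT h -> (forall p, 0 <= h p) ->
  \int[lebesgue_tuple d]_p h (translate v p) = \int[lebesgue_tuple d]_p h p.
Proof.
elim: d => [|d IH] in v h * => mh h0.
  by apply: eq_integral => p _; congr h; rewrite [LHS]tuple0 [RHS]tuple0.
rewrite !ge0_integral_lebesgue_tupleS//; last first.
  by apply: (measurableT_comp mh); exact: measurable_translate.
have mcons : measurable_fun setT (h \o @pcons R d).
  exact: measurableT_comp mh (@measurable_pcons R d).
under eq_integral => x _.
  under eq_integral => p _ do rewrite translate_pcons.
  rewrite (IH _ (fun p => h (pcons ((x + v ord0)%R, p))))//; last first.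
    exact: measurableT_comp mcons (pair1_measurable _).
  over.
rewrite (@ge0_integral_lebesgueD
  (fun x => \int[lebesgue_tuple d]_p h (pcons (x, p))))//.
  exact: (measurable_fun_fubini_tonelli_F (h \o @pcons R d) mcons (fun=> h0 _)).
by move=> x; exact: integral_ge0.
Qed.

Definition segment_point d (u : 'I_d -> R) (z : Rpoint R d) (s : R) : Rpoint R d :=
  translate (fun i => s * u i)%R z.

Lemma tnth_segment_point d (u : 'I_d -> R) z s i :
  tnth (segment_point u z s) i = (tnth z i + s * u i)%R.
Proof. exact: tnth_translate. Qed.

Lemma measurable_segment_point (disp : measure_display) (T : measurableType disp)
    d (u : 'I_d -> R) (f : T -> Rpoint R d) (g : T -> mR) :
  measurable_fun setT f -> measurable_fun setT g ->
  measurable_fun setT (fun x => segment_point u (f x) (g x)).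
Proof.
move=> mf mg; apply: measurable_translate => // i.
by apply: measurable_funM => //; exact: measurable_cst.
Qed.

Lemma measurable_segment_preimage d (u : 'I_d -> R) (z : Rpoint R d)
    (A : set (Rpoint R d)) :
  measurable A -> measurable [set s : mR | A (segment_point u z s)].
Proof.
apply: (@measurable_preimageT _ _ mR _ (segment_point u z)).
by apply: (measurable_segment_point u (f := fun=> z) (g := id)).
Qed.

Lemma ge0_integral_segments d (u : 'I_d -> R) (h : Rpoint R d -> \bar R) :
  measurable_fun setT h -> (forall p, 0 <= h p) ->
  \int[lebesgue_tuple d]_p h p =
  \int[lebesgue_tuple d]_p
    \int[leb]_(s in `[0%R, 1%R]) h (segment_point u p s).
Proof.
move=> mh h0; set I := `[0%R : R, 1%R]%classic.
have leb_I : leb I = 1 by exact: lebesgue_measure_unit_itv.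
pose g (z : mR * Rpoint R d) := h (segment_point u z.2 z.1).
have mg : measurable_fun setT g.
  by apply: (measurableT_comp mh); exact: measurable_segment_point.
transitivity (\int[leb]_(s in I) \int[lebesgue_tuple d]_p g (s, p)).
  rewrite -[LHS]mule1 -[X in _ * X = _]leb_I -integral_cst//; last exact: measurable_itv.
  by apply: eq_integral => s _; rewrite /g/= ge0_integral_translate.
rewrite integral_mkcond epatch_indic.
have mgI : measurable_fun setT (fun z : mR * Rpoint R d => g z * (\1_I z.1)%:E).
  apply: emeasurable_funM => //; apply/measurable_EFinP.
  apply: (measurableT_comp (f := \1_I : mR -> mR)); last exact: measurable_fst.
  by apply: measurable_indic; exact: measurable_itv.
transitivity (\int[leb]_s \int[lebesgue_tuple d]_p (g (s, p) * (\1_I s)%:E)).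
  apply: eq_integral => s _; rewrite ge0_integralZr// => [|p _]; last exact: h0.
  exact: measurableT_comp mg (pair1_measurable _).
transitivity (\int[lebesgue_tuple d]_p \int[leb]_s (g (s, p) * (\1_I s)%:E)).
  by apply: (fubini_tonelli _ mgI) => z; rewrite mule_ge0 ?lee_fin//; exact: h0.
by apply: eq_integral => p _; rewrite [RHS]integral_mkcond epatch_indic.
Qed.

End lebesgue_translation.

Section coordinatewise_distances.
Context {R : realType}.
Local Notation mR := (measurableTypeR R).

Definition sup_dist d (p q : Rpoint R d) : R :=
  \big[Num.max/0]_(i < d) `|(tnth p i : R) - tnth q i|.

Lemma sup_dist_leP d (p q : Rpoint R d) r : 0 <= r ->
  reflect (forall i, `|(tnth p i : R) - tnth q i| <= r) (sup_dist p q <= r).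
Proof.
move=> r0; apply: (iffP (bigmax_leP _ _ _ _)) => [[_ pq] i|pq]; first exact: pq.
by split=> // i _.
Qed.

Lemma sup_dist_ge d (p q : Rpoint R d) i :
  `|(tnth p i : R) - tnth q i| <= sup_dist p q.
Proof. exact: (le_bigmax _ (fun i => `|(tnth p i : R) - tnth q i|)). Qed.

Lemma sup_dist_attained d (p q : Rpoint R d) : (0 < d)%N ->
  exists i, `|(tnth p i : R) - tnth q i| = sup_dist p q.
Proof.
move=> d0; have [||i _ E] // := @eq_bigmax _ _ _ 0 (Ordinal d0) xpredT
  (fun i : 'I_d => `|(tnth p i : R) - tnth q i|).
by exists i; rewrite /sup_dist E.
Qed.

Lemma dist2_ge0 d (p q : Rpoint R d) : 0 <= dist2 p q.
Proof. exact: sqrtr_ge0. Qed.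

Lemma dist2C d (p q : Rpoint R d) : dist2 p q = dist2 q p.
Proof. by congr Num.sqrt; apply: eq_bigr => j _; rewrite -sqrrN opprB. Qed.

Lemma dist2xx d (p : Rpoint R d) : dist2 p p = 0.
Proof. by rewrite /dist2 big1 ?sqrtr0// => j _; rewrite subrr expr0n. Qed.

Lemma unit_cube_dist_le1 d (p q : Rpoint R d) i : unit_cube p -> unit_cube q ->
  `|(tnth p i : R) - tnth q i| <= 1.
Proof.
move=> /(_ i)/andP[p0 p1] /(_ i)/andP[q0 q1].
by rewrite ler_norml; apply/andP; split; lra.
Qed.

Lemma sup_dist_unit_cube d (p q : Rpoint R d) :
  unit_cube p -> unit_cube q -> sup_dist p q <= 1.
Proof. by move=> cp cq; apply/sup_dist_leP => // i; exact: unit_cube_dist_le1. Qed.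

Lemma dist2_unit_cube d (p q : Rpoint R d) :
  unit_cube p -> unit_cube q -> dist2 p q <= Num.sqrt d%:R.
Proof.
move=> cp cq; apply: ler_wsqrtr.
rewrite -[X in X%:R]card_ord -sumr_const; apply: ler_sum => j _.
by rewrite -real_normK ?num_real// expr_le1// unit_cube_dist_le1.
Qed.

Lemma measurable_unit_cube d : measurable (@unit_cube R d).
Proof.
rewrite (_ : unit_cube = \bigcap_(j in [set: 'I_d]) [set p | 0 <= (tnth p j : R) <= 1]).
  apply: fin_bigcap_measurable => // j _.
  have := measurable_preimageT (@measurable_tnth _ mR d j) (measurable_itv `[0, 1]).
  by congr measurable; apply/seteqP; split => p /=; rewrite in_itv.
by apply/seteqP; split => [p h j _|p h j]; exact: h.
Qed.

Section measurability.
Context {disp : measure_display} {T : measurableType disp} {d : nat}.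
Variables f g : T -> Rpoint R d.
Hypotheses (mf : measurable_fun setT f) (mg : measurable_fun setT g).

Lemma measurable_tnthB i :
  measurable_fun setT (fun x => (tnth (f x) i : R) - tnth (g x) i).
Proof.
by apply: measurable_funB; exact: measurableT_comp (@measurable_tnth _ _ _ _) _.
Qed.

Lemma measurable_dist2 : measurable_fun setT (fun x => dist2 (f x) (g x)).
Proof.
apply: (@measurableT_comp _ _ _ _ _ _ (@Num.sqrt R)).
  by apply: continuous_measurable_fun; exact: sqrt_continuous.
apply: measurable_sum => i; apply: measurable_funX.
exact: measurable_tnthB.
Qed.

Lemma measurable_sup_dist : measurable_fun setT (fun x => sup_dist (f x) (g x)).
Proof.
rewrite /sup_dist; elim: (index_enum _) => [|i s IH].
  by under eq_fun do rewrite big_nil; exact: measurable_cst.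
under eq_fun do rewrite big_cons; apply: measurable_maxr => //.
by apply: measurableT_comp => //; exact: measurable_tnthB.
Qed.

Lemma measurable_preimage_unit_cube : measurable [set x | unit_cube (f x)].
Proof. exact: measurable_preimageT mf (@measurable_unit_cube d). Qed.

End measurability.

Lemma measurable_sup_ball d (b : Rpoint R d) r :
  measurable [set p | sup_dist p b <= r].
Proof.
rewrite -[X in measurable X]setTI; apply: measurable_fun_le => //.
by apply: measurable_sup_dist; [exact: measurable_id|exact: measurable_cst].
Qed.

Lemma lebesgue_sup_ball d (b : Rpoint R d) (r : R) : 0 <= r ->
  lebesgue_tuple d [set p | sup_dist p b <= r] = ((2 * r) ^+ d)%:E.
Proof.
move=> r0; elim: d => [|d IH] in b *.
  by rewrite /= diracE mem_set// /= /sup_dist big_ord0.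
case/tupleP: b => b0 b; rewrite /= /lebesgue_cons /pushforward.
rewrite (_ : _ @^-1` _ =
    `[b0 - r, b0 + r]%classic `*` [set p | sup_dist p b <= r]); last first.
  apply/seteqP; split => -[x p] /=.
    move=> /sup_dist_leP bp; split.
      by have := bp r0 ord0; rewrite !tnth0 in_itv/= ler_distl.
    by apply/sup_dist_leP => // i; have := bp r0 (lift ord0 i); rewrite !tnthS.
  move=> []; rewrite in_itv/= -ler_distl => bx /sup_dist_leP bp.
  apply/sup_dist_leP => // i.
  case: (unliftP ord0 i) => [j|] ->; rewrite ?tnthS ?tnth0//; exact: bp.
rewrite product_measure1E//; last exact: measurable_sup_ball.
rewrite IH /= lebesgue_measure_itv/= lte_fin exprS EFinM; congr (_ * _)%E.
case: ltP => rr; last by congr EFin; lra.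
by rewrite -EFinB; congr EFin; ring.
Qed.

Lemma lebesgue_unit_cube_le1 d : (lebesgue_tuple d (@unit_cube R d) <= 1)%E.
Proof.
pose center : Rpoint R d := [tuple (2^-1 : R) | i < d].
apply: (@le_trans _ _ (lebesgue_tuple d [set p | sup_dist p center <= 2^-1])).
  apply: le_measure; rewrite ?inE//.
  - exact: measurable_unit_cube.
  - exact: measurable_sup_ball.
  move=> p cp /=; apply/sup_dist_leP => [|i]; first by rewrite invr_ge0.
  rewrite tnth_mktuple ler_norml; have /andP[? ?] := cp i.
  by apply/andP; split; lra.
by rewrite lebesgue_sup_ball ?invr_ge0// divff// expr1n.
Qed.

End coordinatewise_distances.

(** * Differences of two distances along parallel lines *)

Section second_difference.
Context {R : realType}.

(* With [N t = A t ^+ 2 + 2 B t + C], the products p q' and q p' are bounded below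
   by the bilinear form of [N] (Cauchy-Schwarz), and the difference of
   (p + q') ^+ 2 and (q + p') ^+ 2 is explicit up to these products. *)
Lemma second_difference_sqrt_quadratic (A B C D r s s' p q p' q' : R) :
  let N t := A * t ^+ 2 + 2 * B * t + C in
  0 <= A -> 0 <= A * C - B ^+ 2 ->
  0 <= p <= D -> 0 <= q <= D -> 0 <= p' <= D -> 0 <= q' <= D ->
  p ^+ 2 = N (s - r) -> q ^+ 2 = N s -> p' ^+ 2 = N (s' - r) -> q' ^+ 2 = N s' ->
  (A * C - B ^+ 2) * `|r * (s' - s)| <= D ^+ 3 * `|(p - q) - (p' - q')|.
Proof.
move=> N A0 G0 /andP[p0 pD] /andP[q0 qD] /andP[p'0 p'D] /andP[q'0 q'D] Ep Eq Ep' Eq'.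
set G := A * C - B ^+ 2 in G0 *.
set outer := A * (s - r) * s' + B * (s - r + s') + C.
set inner := A * s * (s' - r) + B * (s + (s' - r)) + C.
have outerE : (p * q') ^+ 2 = outer ^+ 2 + G * (s' - s + r) ^+ 2.
  by rewrite exprMn Ep Eq' /N /outer /G; ring.
have innerE : (q * p') ^+ 2 = inner ^+ 2 + G * (s' - s - r) ^+ 2.
  by rewrite exprMn Eq Ep' /N /inner /G; ring.
have le_of_sqr (x y z : R) : 0 <= y -> y ^+ 2 = x ^+ 2 + G * z ^+ 2 -> x <= y.
  move=> y0 yE; apply: (le_trans (ler_norm _)).
  rewrite -(@ler_pXn2r _ 2)// ?nnegrE// real_normK ?num_real// yE.
  by rewrite lerDl mulr_ge0 ?sqr_ge0.
have outer_le : outer <= p * q'.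
  by apply: (le_of_sqr _ _ _ _ outerE); exact: mulr_ge0.
have inner_le : inner <= q * p'.
  by apply: (le_of_sqr _ _ _ _ innerE); exact: mulr_ge0.
have gapE : (p * q' + q * p') * (p + q' + q + p') * ((p - q) - (p' - q')) =
    2 * (r * (s' - s)) * (A * (p * q' + q * p' - outer - inner) + 4 * G).
  transitivity ((p * q' + q * p') * (p ^+ 2 + q' ^+ 2 - q ^+ 2 - p' ^+ 2) +
    2 * ((p * q') ^+ 2 - (q * p') ^+ 2)); first by ring.
  by rewrite outerE innerE Ep Eq Ep' Eq' /N /outer /inner /G; ring.
have bracket_ge : 4 * G <= A * (p * q' + q * p' - outer - inner) + 4 * G.
  by rewrite lerDr mulr_ge0//; lra.
have prod_ge0 : 0 <= (p * q' + q * p') * (p + q' + q + p').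
  by rewrite mulr_ge0 ?addr_ge0 ?mulr_ge0.
have prod_le : (p * q' + q * p') * (p + q' + q + p') <= 8 * D ^+ 3.
  have -> : 8 * D ^+ 3 = (D * D + D * D) * (D + D + D + D) by ring.
  by rewrite ler_pM ?addr_ge0 ?mulr_ge0// !lerD// ler_pM.
rewrite -(@ler_pM2l _ 8)// mulrCA.
apply: (@le_trans _ _
    `|2 * (r * (s' - s)) * (A * (p * q' + q * p' - outer - inner) + 4 * G)|).
  rewrite [leRHS]normrM [X in _ <= _ * X]ger0_norm; last by lra.
  rewrite [`|2 * _|]normrM [`|2|]ger0_norm//.
  by have := normr_ge0 (r * (s' - s)); nra.
by rewrite -gapE normrM ger0_norm// mulrA ler_wpM2r.
Qed.

(* A single term of Lagrange's identity. *)
Lemma sqr_minor_le_gram (I : finType) (x y : I -> R) (i j : I) :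
  (x i * y j - x j * y i) ^+ 2 <=
  (\sum_k x k ^+ 2) * (\sum_k y k ^+ 2) - (\sum_k x k * y k) ^+ 2.
Proof.
pose minor2 k l := (x k * y l - x l * y k) ^+ 2.
have minor2_ge0 k l : 0 <= minor2 k l by exact: sqr_ge0.
have lagrange : \sum_k \sum_l minor2 k l =
    2 * ((\sum_k x k ^+ 2) * (\sum_k y k ^+ 2) - (\sum_k x k * y k) ^+ 2).
  transitivity (\sum_k \sum_l (x k ^+ 2 * y l ^+ 2 + y k ^+ 2 * x l ^+ 2
      - 2 * (x k * y k) * (x l * y l))).
    by apply: eq_bigr => k _; apply: eq_bigr => l _; rewrite /minor2; ring.
  under eq_bigr do rewrite big_split big_split sumrN /=.
  rewrite !big_split sumrN /= -!big_distrlr /= -mulr_sumr; ring.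
rewrite -(@ler_pM2l _ 2)// -lagrange -/(minor2 i j).
have row_ge0 k : 0 <= \sum_l minor2 k l by apply: sumr_ge0 => l _.
have [->|ij] := eqVneq i j.
  by rewrite /minor2 subrr expr0n mulr0; apply: sumr_ge0 => k _; exact: row_ge0.
have le_row k l : minor2 k l <= \sum_l' minor2 k l'.
  by rewrite (bigD1 l)//= lerDl sumr_ge0.
have minor2C : minor2 j i = minor2 i j by rewrite /minor2 -sqrrN opprB.
rewrite (bigD1 i)//= [X in _ + X](bigD1 j) 1?eq_sym//= addrA -[leLHS]addr0.
rewrite mulr_natl mulr2n -{2}minor2C.
by rewrite !lerD// ?le_row// sumr_ge0// => k _; exact: row_ge0.
Qed.

End second_difference.

Section parallel_lines.
Context {R : realType} {d : nat}.
Local Notation mR := (measurableTypeR R).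
Local Notation leb := (@lebesgue_measure R).
Local Notation point := (Rpoint R d).
Variables (b : point) (u : 'I_d -> R) (j k : 'I_d).

(* Vanishes on the line through [b] in direction [u]. *)
Definition cross (x : point) : R :=
  u j * ((tnth x k : R) - tnth b k) - u k * ((tnth x j : R) - tnth b j).

Lemma measurable_cross : measurable_fun setT cross.
Proof.
apply: measurable_funB; apply: measurable_funM; try exact: measurable_cst;
  apply: measurable_tnthB; by [exact: measurable_id|exact: measurable_cst].
Qed.

Lemma cross_segment_point z s : cross (segment_point u z s) = cross z.
Proof. by rewrite /cross !tnth_segment_point; ring. Qed.

Lemma sqr_dist2_segment_point z s t :
  let y i : R := (tnth z i : R) - tnth b i in
  dist2 (segment_point u z s) (segment_point u b t) ^+ 2 =
  (\sum_i u i ^+ 2) * (s - t) ^+ 2 + 2 * (\sum_i u i * y i) * (s - t) + \sum_i y i ^+ 2.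
Proof.
move=> y; rewrite sqr_sqrtr; last by apply: sumr_ge0 => i _; exact: sqr_ge0.
rewrite mulr_sumr !mulr_suml -!big_split; apply: eq_bigr => i _.
by rewrite !tnth_segment_point /y /=; ring.
Qed.

Lemma dist2_difference_segment_point z (rho D s s' : R) :
  let a := segment_point u b rho in
  let F x := dist2 x a - dist2 x b in
  let x := segment_point u z s in let x' := segment_point u z s' in
  dist2 x a <= D -> dist2 x b <= D -> dist2 x' a <= D -> dist2 x' b <= D ->
  cross z ^+ 2 * `|rho * (s' - s)| <= D ^+ 3 * `|F x - F x'|.
Proof.
move=> a F x x' xa xb x'a x'b.
pose y i : R := (tnth z i : R) - tnth b i.
have gram := sqr_minor_le_gram u y j k.
have b0 : b = segment_point u b 0.
  by apply: eq_from_tnth => i; rewrite tnth_segment_point mul0r addr0.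
have sqrb t : dist2 (segment_point u z t) b ^+ 2 =
    (\sum_i u i ^+ 2) * t ^+ 2 + 2 * (\sum_i u i * y i) * t + \sum_i y i ^+ 2.
  by rewrite [in LHS]b0 sqr_dist2_segment_point subr0.
apply: (@le_trans _ _ (((\sum_i u i ^+ 2) * (\sum_i y i ^+ 2) -
    (\sum_i u i * y i) ^+ 2) * `|rho * (s' - s)|)).
  by rewrite ler_wpM2r//; exact: gram.
apply: second_difference_sqrt_quadratic;
  rewrite ?dist2_ge0 ?sqrb ?sqr_dist2_segment_point//.
- by apply: sumr_ge0 => i _; exact: sqr_ge0.
- exact: le_trans (sqr_ge0 _) gram.
Qed.

Lemma lebesgue_segment_level z (rho eps t : R) (E : set mR) : measurable E ->
  let a := segment_point u b rho in
  0 < rho -> 0 <= eps -> cross z != 0 -> unit_cube a -> unit_cube b ->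
  (forall s, E s -> unit_cube (segment_point u z s) /\
    `|dist2 (segment_point u z s) a - dist2 (segment_point u z s) b - t| <= eps) ->
  (leb E <= (4 * Num.sqrt d%:R ^+ 3 * eps / rho / cross z ^+ 2)%:E)%E.
Proof.
move=> mE a rho0 eps0 w0 ca cb levelE.
have w2 : 0 < cross z ^+ 2 by rewrite exprn_even_gt0.
have S3 : 0 <= Num.sqrt d%:R ^+ 3 :> R by rewrite exprn_ge0.
rewrite (_ : 4 * _ * _ / _ / _ =
    2 * (2 * Num.sqrt d%:R ^+ 3 * eps / rho / cross z ^+ 2)); last by ring.
apply: lebesgue_measure_le_diameter => //.
  by rewrite divr_ge0 ?sqr_ge0// divr_ge0 ?(ltW rho0)// !mulr_ge0.
move=> s s' /levelE[cs Fs] /levelE[cs' Fs'].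
rewrite !ler_pdivlMr//.
have -> : `|s - s'| * cross z ^+ 2 * rho = cross z ^+ 2 * `|rho * (s' - s)|.
  by rewrite normrM gtr0_norm// distrC; ring.
apply: le_trans (dist2_difference_segment_point _ _ _ _) _;
  try exact: dist2_unit_cube.
rewrite -[leRHS]mulrA [leRHS]mulrCA ler_wpM2l//.
by move: Fs Fs'; rewrite !ler_norml => /andP[? ?] /andP[? ?]; apply/andP; split; lra.
Qed.

End parallel_lines.

Section slabs.
Context {R : realType} {d : nat}.
Local Notation mR := (measurableTypeR R).
Local Notation leb := (@lebesgue_measure R).
Local Notation point := (Rpoint R d).
Local Notation lam := (@lebesgue_tuple R d).

Lemma sup_dist_segment_point (b z : point) (u : 'I_d -> R) (r s : R) :
  (forall i, `|u i| <= 1) -> 0 <= r -> s \in `[0, 1] ->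
  sup_dist (segment_point u z s) b <= r -> sup_dist z b <= r + 1.
Proof.
move=> u1 r0; rewrite in_itv/= => /andP[s0 s1] /(sup_dist_leP _ _ r0) zb.
apply/sup_dist_leP => [|i]; first exact: addr_ge0.
have su : `|s * u i| <= 1 by rewrite normrM mulr_ile1// ger0_norm.
move: (zb i) su; rewrite tnth_segment_point !ler_norml => /andP[? ?] /andP[? ?].
by apply/andP; split; lra.
Qed.

Lemma lebesgue_segments_le (u : 'I_d -> R) (b : point) (r m : R) (A : set point) :
  measurable A -> (forall i, `|u i| <= 1) -> 0 <= r -> 0 <= m ->
  (forall x, A x -> sup_dist x b <= r) ->
  (forall z, (leb [set s | A (segment_point u z s)] <= m%:E)%E) ->
  (lam A <= (m * (2 * (r + 1)) ^+ d)%:E)%E.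
Proof.
move=> mA u1 r0 m0 Ab Am.
rewrite -(setIT A) -integral_indic// (ge0_integral_segments u)//; last first.
  exact/measurable_EFinP/measurable_indic.
rewrite EFinM -(lebesgue_sup_ball b) ?addr_ge0//.
have mAz z := measurable_segment_preimage u z mA.
have segmentE z : (\int[leb]_(s in `[0%R, 1%R]) (\1_A (segment_point u z s))%:E)%E =
    leb ([set s | A (segment_point u z s)] `&` `[0, 1]%classic).
  rewrite -integral_indic//; exact: measurable_itv.
apply: integral_le_mul_measure => [|//|z _|z zb].
- exact: measurable_sup_ball.
- rewrite segmentE; apply: le_trans (Am z); apply: le_measure; rewrite ?inE//.
  by apply: measurableI => //; exact: measurable_itv.
- rewrite segmentE (_ : _ `&` _ = set0) ?measure0//.
  apply/seteqP; split => // s [/= As s01].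
  by apply: zb; exact: sup_dist_segment_point u1 r0 s01 (Ab _ As).
Qed.

Lemma lebesgue_slab_le (u : 'I_d -> R) (b : point) (j k : 'I_d) (r v : R) :
  k != j -> `|u j| = 1 -> 0 <= r -> 0 <= v ->
  (lam [set x | (sup_dist x b <= r)%R /\ (`|cross b u j k x| <= v)%R]
    <= (4 * v * (2 * (r + 1)) ^+ d)%:E)%E.
Proof.
move=> kj uj r0 v0.
have mslab : measurable [set x | sup_dist x b <= r /\ `|cross b u j k x| <= v].
  apply: measurable_fun_le => //; first exact: measurable_sup_ball.
  apply: measurable_funTS; apply: measurableT_comp => //; exact: measurable_cross.
pose e i : R := (i == k)%:R.
have cross_e z s : cross b u j k (segment_point e z s) = cross b u j k z + u j * s.
  by rewrite /cross !tnth_segment_point /e eqxx [j == k]eq_sym (negbTE kj) /=; ring.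
apply: (@lebesgue_segments_le e b) => [//|i|//||x []//|z].
- by rewrite /e; case: eqP; rewrite ?normr1 ?normr0.
- exact: mulr_ge0.
rewrite (_ : 4 * v = 2 * (2 * v)); last by ring.
apply: lebesgue_measure_le_diameter => [||s s' [_]].
- exact: measurable_segment_preimage.
- exact: mulr_ge0.
rewrite cross_e => Es [_]; rewrite cross_e => Es'.
have -> : `|s - s'| = `|u j * (s - s')| by rewrite normrM uj mul1r.
by move: Es Es'; rewrite !ler_norml => /andP[? ?] /andP[? ?]; apply/andP; split; lra.
Qed.

End slabs.

(** * Pairs of points with nearly equal distance differences *)

Section two_points.
Context {R : realType}.

(* The slab [`|cross| <= v] in the ball of sup radius 2 has measure at most 4 v times
   that of the ball of radius 3. *)
Definition slab_const (d : nat) : R := 4 * 6 ^+ d.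

Lemma slab_const_ge4 d : 4 <= slab_const d.
Proof. by rewrite ler_peMr// exprn_ege1// ler1n. Qed.

Lemma sqrt_natr_ge1 d : (0 < d)%N -> 1 <= Num.sqrt d%:R :> R.
Proof. by move=> d0; rewrite -[leLHS]sqrtr1 ler_wsqrtr// ler1n. Qed.

Definition pair_level_const (d : nat) : R :=
  8 * slab_const d ^+ 2 * Num.sqrt d%:R ^+ 3.

Lemma pair_level_const_ge1 d : (0 < d)%N -> 1 <= pair_level_const d.
Proof.
move=> d0; have slab_ge1 : 1 <= slab_const d.
  by apply: le_trans (slab_const_ge4 d); rewrite ler1n.
by rewrite !mulr_ege1 ?exprn_ege1 ?sqrt_natr_ge1 ?ler1n.
Qed.

Context {d : nat}.
Local Notation mR := (measurableTypeR R).
Local Notation leb := (@lebesgue_measure R).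
Local Notation point := (Rpoint R d).
Local Notation lam := (@lebesgue_tuple R d).
Variables (a b : point) (eps : R).

Definition pair_level : set (point * point) :=
  [set z | [/\ unit_cube z.1, unit_cube z.2 &
    `|(dist2 z.1 a - dist2 z.1 b) - (dist2 z.2 a - dist2 z.2 b)| <= eps]].

Lemma measurable_pair_level : measurable pair_level.
Proof.
rewrite (_ : pair_level = [set z | unit_cube z.1] `&` [set z | unit_cube z.2] `&`
  [set z | `|(dist2 z.1 a - dist2 z.1 b) - (dist2 z.2 a - dist2 z.2 b)| <= eps]).
  apply: measurable_fun_le; last exact: measurable_cst.
    by apply: measurableI; exact: measurable_preimage_unit_cube.
  apply: measurable_funTS; apply: measurableT_comp => //; apply: measurable_funB;
    apply: measurable_funB; apply: measurable_dist2 => //; exact: measurable_cst.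
by apply/seteqP; split => [z []//|z [[]]].
Qed.

Section direction.
Variables (u : 'I_d -> R) (rho : R) (j k : 'I_d) (J : nat).
Hypotheses (aE : a = segment_point u b rho) (u_le1 : forall i, `|u i| <= 1).
Hypotheses (uj : `|u j| = 1) (kj : k != j).
Hypotheses (rho_gt0 : 0 < rho) (rho_le1 : rho <= 1).
Hypotheses (ca : unit_cube a) (cb : unit_cube b) (eps_gt0 : 0 < eps).
Hypothesis (epsJ : 1 <= eps * J%:R).

Let height (x : point) : R := `|cross b u j k x|.
Let K : R := slab_const d * (4 * Num.sqrt d%:R ^+ 3 * eps / rho).

Let d_gt0 : (0 < d)%N. Proof. by case: d j => // -[]. Qed.

Let measurable_height : measurable_fun setT height.
Proof. by apply: measurableT_comp => //; exact: measurable_cross. Qed.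

Let slab (v : R) : set point :=
  [set x | sup_dist x b <= 2] `&` [set x | height x <= v].

Let measurable_slab v : measurable (slab v).
Proof.
apply: measurable_fun_le => //; first exact: measurable_sup_ball.
by apply: measurable_funTS.
Qed.

Let lebesgue_slab v : 0 <= v -> (lam (slab v) <= (slab_const d * v)%:E)%E.
Proof.
move=> v0; apply: (le_trans (lebesgue_slab_le b kj uj (ler0n _ 2) v0)).
by rewrite lee_fin mulrAC (_ : 2 * (2 + 1) = 6)//; ring.
Qed.

Let upper_half : set (point * point) :=
  pair_level `&` [set z | height z.2 <= height z.1].

Let measurable_upper_half : measurable upper_half.
Proof.
apply: measurable_fun_le; first exact: measurable_pair_level.
  by apply: measurable_funTS; exact: measurableT_comp measurable_height measurable_snd.
by apply: measurable_funTS; exact: measurableT_comp measurable_height measurable_fst.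
Qed.

Let segment_integral (z : point) : \bar R :=
  (\int[leb]_(s in `[0%R, 1%R]) lam (xsection upper_half (segment_point u z s)))%E.

Let segment_integral_le1 z : (segment_integral z <= 1)%E.
Proof.
rewrite -[leRHS]mule1 -[X in (_ <= _ * X)%E]lebesgue_measure_unit_itv.
rewrite /segment_integral integral_mkcond; apply: integral_le_mul_measure => // s.
  move=> s01; rewrite patchE mem_set//.
  apply: le_trans (lebesgue_unit_cube_le1 d); apply: le_measure; rewrite ?inE.
  - exact: measurable_xsection.
  - exact: measurable_unit_cube.
  - by move=> c; rewrite /xsection/= inE => -[[]].
by move=> s01; rewrite patchE memNset.
Qed.

Let segment_integral_le_div z : 0 < height z ->
  (segment_integral z <= (K / height z)%:E)%E.
Proof.
move=> hz; pose A := [set y : mR * point | upper_half (segment_point u z y.1, y.2)].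
have mA : measurable A.
  apply: (@measurable_preimageT _ _ (mR * point)%type _
    (fun y => (segment_point u z y.1, y.2))) => //.
  apply: measurable_fun_pair measurable_snd.
  by apply: measurable_segment_point => //; exact: measurable_cst.
apply: (@le_trans _ _ ((leb \x lam) A)%E).
  rewrite /segment_integral integral_mkcond; apply: le_integral_ge0 => // s.
  by rewrite patchE; case: ifP => _; [exact: lexx|exact: measure_ge0].
have -> : K / height z =
    4 * Num.sqrt d%:R ^+ 3 * eps / rho / cross b u j k z ^+ 2 *
    (slab_const d * height z).
  rewrite /K -[cross _ _ _ _ _ ^+ 2]real_normK ?num_real// -/(height z).
  by field; rewrite !gt_eqF.
have lineK_ge0 : 0 <= 4 * Num.sqrt d%:R ^+ 3 * eps / rho / cross b u j k z ^+ 2.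
  rewrite !divr_ge0 ?sqr_ge0 ?mulr_ge0 ?exprn_ge0 ?sqrtr_ge0//; exact: ltW.
rewrite EFinM; apply: le_trans (lee_wpmul2l _ (lebesgue_slab (ltW hz))); last first.
  by rewrite lee_fin.
apply: product_measure_le_fibers => [//||//|c|[s c] [[/= _ cc _] hc]].
- exact: measurable_slab.
- apply: (@lebesgue_segment_level _ _ b u j k z rho eps (dist2 c a - dist2 c b)) => //.
  + exact: measurable_ysection.
  + exact: ltW.
  + by rewrite -normr_gt0.
  + by rewrite -aE.
  + by move=> s; rewrite /ysection/= inE -aE => -[[]].
- split=> /=; first by apply: (le_trans (sup_dist_unit_cube cc cb)); rewrite ler1n.
  by move: hc; rewrite /height /= cross_segment_point.
Qed.

Let segment_integral_le0 z : ~ sup_dist z b <= 2 -> (segment_integral z <= 0)%E.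
Proof.
move=> zb; rewrite /segment_integral integral0_eq// => s s01.
rewrite (_ : xsection _ _ = set0) ?measure0//; apply/seteqP; split => // c.
rewrite /xsection/= inE => -[[/= cz _ _] _]; apply: zb.
rewrite -[2]/(1 + 1); apply: (sup_dist_segment_point u_le1 _ s01) => //.
exact: sup_dist_unit_cube.
Qed.

Let lebesgue_upper_half_le :
  ((lam \x lam) upper_half <= (K * (slab_const d * (1 + series harmonic J)))%:E)%E.
Proof.
have S_ge1 : 1 <= Num.sqrt d%:R ^+ 3 :> R.
  by rewrite exprn_ege1// (sqrt_natr_ge1 d_gt0).
have K_ge : eps <= K.
  have level_ge : eps <= 4 * Num.sqrt d%:R ^+ 3 * eps / rho.
    rewrite ler_pdivlMr//; apply: (@le_trans _ _ eps); first by rewrite ler_piMr// ltW.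
    by rewrite ler_peMl ?(ltW eps_gt0)//; lra.
  rewrite /K (le_trans level_ge)// ler_peMl ?(le_trans (ltW eps_gt0) level_ge)//.
  by apply: le_trans (slab_const_ge4 _); rewrite ler1n.
rewrite [leLHS](ge0_integral_segments u)//; last exact: measurable_fun_xsection.
rewrite mulrDr mulr1 mulr_sumr.
apply: (integral_layer_le (D := [set z | sup_dist z b <= 2]) (w := height)).
- exact: measurable_sup_ball.
- exact: measurable_height.
- exact: le_trans (ltW eps_gt0) K_ge.
- by apply: (le_trans epsJ); rewrite ler_wpM2r.
- exact: segment_integral_le0.
- exact: segment_integral_le1.
- exact: segment_integral_le_div.
- rewrite [leLHS](lebesgue_sup_ball b (ler0n _ 2)) lee_fin.
  apply: (@le_trans _ _ (6 ^+ d)).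
    by rewrite lerXn2r ?nnegrE ?mulr_ge0//; lra.
  by rewrite ler_peMl ?exprn_ge0//; lra.
- by move=> l; exact: (lebesgue_slab (harmonic_ge0 l)).
Qed.

Lemma lebesgue_pair_level_direction_le :
  ((lam \x lam) pair_level <= (2 * (K * (slab_const d * (1 + series harmonic J))))%:E)%E.
Proof.
pose lower_half := upper_half^-1%relation.
have mlower : measurable lower_half.
  apply: (measurable_preimageT (f := fun z => (z.2, z.1))) => //.
  exact: measurable_fun_pair measurable_snd measurable_fst.
rewrite mulr_natl mulr2n EFinD.
apply: (@le_trans _ _ ((lam \x lam) (upper_half `|` lower_half))%E).
  apply: le_measure; rewrite ?inE//.
  - exact: measurable_pair_level.
  - exact: measurableU.
  move=> [x c] [cx cc Fxc]; have [h|h] := leP (height c) (height x); [left|right] => //.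
  by split; rewrite /= ?(ltW h)//; split => //=; rewrite distrC.
apply: (le_trans (measureU2 _ _ _)) => //.
apply: leeD; first exact: lebesgue_upper_half_le.
rewrite [leLHS](product_measure_swap lam measurable_upper_half).
exact: lebesgue_upper_half_le.
Qed.

End direction.

Lemma lebesgue_pair_level_le (J : nat) : (1 < d)%N ->
  unit_cube a -> unit_cube b -> 0 < sup_dist a b -> 0 < eps -> 1 <= eps * J%:R ->
  ((lam \x lam) pair_level <=
    (pair_level_const d * (eps * (1 + series harmonic J)) / sup_dist a b)%:E)%E.
Proof.
move=> d1 ca cb ab0 eps0 epsJ; have d0 : (0 < d)%N by exact: ltnW.
have [j abj] := sup_dist_attained a b d0.
have [k kj] : exists k, k != j.
  by have [<-|] := eqVneq (Ordinal d0) j; [exists (Ordinal d1)|exists (Ordinal d0)].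
pose u i := ((tnth a i : R) - tnth b i) / sup_dist a b.
have aE : a = segment_point u b (sup_dist a b).
  apply: eq_from_tnth => i; rewrite tnth_segment_point mulrC divfK ?gt_eqF//.
  by rewrite addrC subrK.
apply: (le_trans (lebesgue_pair_level_direction_le aE _ _ kj _ _ ca cb eps0 epsJ)) => //.
- by move=> i; rewrite normrM normfV (gtr0_norm ab0) ler_pdivrMr// mul1r sup_dist_ge.
- by rewrite normrM normfV abj (gtr0_norm ab0) divff// gt_eqF.
- exact: sup_dist_unit_cube.
- rewrite lee_fin le_eqVlt; apply/orP; left; apply/eqP.
  by rewrite /pair_level_const; ring.
Qed.

End two_points.

(** * Independence *)

Section independent_laws.
Local Open Scope ereal_scope.
Context {disp : measure_display} {Omega : measurableType disp} {R : realType}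
  (P : probability Omega R).

(* [Z] is independent of the event [G] and, unless [G] is negligible, has law [m]. *)
Definition indep_law (G : set Omega) (d : measure_display) (T : measurableType d)
    (Z : Omega -> T) (m : set T -> \bar R) : Prop :=
  forall E, measurable E -> P (G `&` Z @^-1` E) = P G * m E.

Lemma indep_law_pair (G : set Omega) (d1 d2 : measure_display)
    (T1 : measurableType d1) (T2 : measurableType d2)
    (m1 : {sigma_finite_measure set T1 -> \bar R})
    (m2 : {sigma_finite_measure set T2 -> \bar R})
    (Y : Omega -> T1) (Z : Omega -> T2) :
  measurable G -> measurable_fun setT Y -> measurable_fun setT Z ->
  indep_law G Y m1 ->
  (forall B, measurable B -> indep_law (G `&` Y @^-1` B) Z m2) ->
  indep_law G (fun w => (Y w, Z w)) (m1 \x m2).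
Proof.
move=> mG mY mZ GY GZ E mE.
have mYZ : measurable_fun setT (fun w => (Y w, Z w)) by exact: measurable_fun_pair.
have mYZE : measurable ((fun w => (Y w, Z w)) @^-1` E).
  exact: measurable_preimageT mYZ mE.
have [PG0|PG0] := eqVneq (P G) 0.
  rewrite PG0 mul0e; apply/eqP; rewrite eq_le measure_ge0 andbT -PG0.
  by apply: le_measure; rewrite ?inE//; exact: measurableI.
have PGfin : P G \is a fin_num by exact: fin_num_measure.
have PG_gt0 : (0 < fine (P G))%R.
  by rewrite fine_gt0// lt0e PG0 measure_ge0 -ge0_fin_numE.
have invPG_ge0 : (0 <= (fine (P G))^-1)%R by rewrite invr_ge0 ltW.
have invPGK x : (fine (P G))^-1%:E * (P G * x) = x.
  by rewrite muleA -{2}(fineK PGfin) -EFinM mulVf ?mul1e// gt_eqF.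
pose conditional := mscale (NngNum invPG_ge0)
  (measure_function_pushforward__canonical__measure_function_Measure
     (mrestr P mG) mYZ).
have conditionalE D : conditional D =
    (fine (P G))^-1%:E * P (G `&` (fun w => (Y w, Z w)) @^-1` D).
  by rewrite /conditional /mscale/= /pushforward /mrestr setIC.
rewrite (product_measure_unique (m' := conditional))// => [|B C mB mC].
  by rewrite [X in P G * X]conditionalE muleCA invPGK.
by rewrite [LHS]conditionalE setIA GZ// GY// -muleA invPGK.
Qed.

End independent_laws.

Section mutual_independence.
Context {R : realType} {n d : nat} {disp : measure_display}
  {Omega : measurableType disp} (P : probability Omega R).
Local Notation point := (Rpoint R d).
Variable X : 'I_n -> {RV P >-> point}.
Hypothesis indX : mutually_independent X.
Implicit Types (i : 'I_n) (J : {set 'I_n}) (A : 'I_n -> set point).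

Definition joint_event J A : set Omega :=
  \bigcap_(i in [set` J]) (X i @^-1` A i).

Lemma measurable_joint_event J A : (forall i, measurable (A i)) ->
  measurable (joint_event J A).
Proof.
move=> mA; apply: fin_bigcap_measurable => [|i _]; first exact: finite_finset.
exact: measurable_funPTI.
Qed.

Lemma joint_eventU1 J A i (E : set point) : i \notin J ->
  joint_event J A `&` X i @^-1` E =
  joint_event (i |: J)%SET (fun l => if l == i then E else A l).
Proof.
move=> iJ; apply/seteqP; split => w.
  move=> [JAw Ew] l /=; rewrite !inE; case: eqP => [->//|_ /= lJ]; exact: JAw.
move=> iJw; split => [l /= lJ|]; last first.
  by have := iJw i; rewrite /= setU11 eqxx; exact.
have := iJw l; rewrite /= inE lJ orbT; case: eqP => [li|_]; last exact.
by rewrite -li lJ in iJ.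
Qed.

Lemma indep_law_RV J A i : (forall l, measurable (A l)) -> i \notin J ->
  indep_law P (joint_event J A) (X i) (distribution P (X i)).
Proof.
move=> mA iJ E mE; rewrite joint_eventU1// /joint_event !indX//; last first.
  by move=> l; case: ifP.
rewrite big_setU1//= eqxx muleC; congr (_ * _)%E.
by apply: eq_bigr => l lJ; case: eqP => // li; rewrite -li lJ in iJ.
Qed.

Lemma indep_law_cons (dT : measure_display) (T : measurableType dT) (Z : Omega -> T)
    (m : {sigma_finite_measure set T -> \bar R}) J A i :
  (forall l, measurable (A l)) -> i \notin J -> measurable_fun setT Z ->
  (forall A', (forall l, measurable (A' l)) ->
     indep_law P (joint_event (i |: J)%SET A') Z m) ->
  indep_law P (joint_event J A) (fun w => (X i w, Z w)) (distribution P (X i) \x m)%E.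
Proof.
move=> mA iJ mZ JZ; apply: indep_law_pair => //.
- exact: measurable_joint_event.
- exact: indep_law_RV.
- by move=> B mB; rewrite joint_eventU1//; apply: JZ => l; case: ifP.
Qed.

Lemma joint_law4 (i j k l : 'I_n) : uniq [:: i; j; k; l] ->
  forall E : set (point * (point * (point * point))), measurable E ->
  P [set w | E (X i w, (X j w, (X k w, X l w)))] =
  (distribution P (X i) \x (distribution P (X j) \x
    (distribution P (X k) \x distribution P (X l))))%E E.
Proof.
rewrite /= !inE !negb_or -!andbA => /and5P[ij ik il jk /and3P[jl kl _]] E mE.
have mX u : measurable_fun setT (X u) by exact: measurable_funP.
pose m2 : probability (point * point)%type R :=
  (distribution P (X k) \x distribution P (X l))%E.
pose m3 : probability (point * (point * point))%type R :=
  (distribution P (X j) \x m2)%E.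
pose J1 := (i |: finset.set0)%SET; pose J2 := (j |: J1)%SET.
have law2 A : (forall u, measurable (A u)) ->
    indep_law P (joint_event J2 A) (fun w => (X k w, X l w)) m2.
  move=> mA; apply: indep_law_cons => // [|A' mA'].
    by rewrite !inE !(eq_sym k) (negbTE ik) (negbTE jk).
  apply: indep_law_RV => //.
  by rewrite !inE !(eq_sym l) (negbTE il) (negbTE jl) (negbTE kl).
have law3 A : (forall u, measurable (A u)) ->
    indep_law P (joint_event J1 A) (fun w => (X j w, (X k w, X l w))) m3.
  move=> mA; apply: indep_law_cons => //; last exact: measurable_fun_pair.
  by rewrite !inE eq_sym (negbTE ij).
have law4 : indep_law P (joint_event finset.set0 (fun=> setT))
    (fun w => (X i w, (X j w, (X k w, X l w)))) (distribution P (X i) \x m3)%E.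
  apply: indep_law_cons => //; first by rewrite inE.
  by apply: measurable_fun_pair => //; exact: measurable_fun_pair.
have := law4 E mE.
rewrite (_ : joint_event _ _ = setT) ?setTI ?probability_setT ?mul1e//.
by apply/seteqP; split => // w _ u; rewrite /= inE.
Qed.

End mutual_independence.

(** * Probability of a small gain *)

Section bounded_density.
Context {R : realType} {d : nat} {disp : measure_display}
  {Omega : measurableType disp} (P : probability Omega R).
Local Notation point := (Rpoint R d).
Variables (phi : R) (f : point -> R) (X : {RV P >-> point}).
Hypotheses (fphi : forall p, unit_cube p -> 0 <= f p <= phi) (Xf : has_density X f).

Lemma distribution_le_lebesgue (A : set point) : 0 <= phi -> measurable A ->
  (distribution P X A <= phi%:E * lebesgue_tuple d A)%E.
Proof.
move=> phi0 mA; rewrite Xf//.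
have mAc : measurable (A `&` unit_cube).
  by apply: measurableI => //; exact: measurable_unit_cube.
apply: (@le_trans _ _ (phi%:E * lebesgue_tuple d (A `&` unit_cube))%E); last first.
  by rewrite lee_wpmul2l ?lee_fin// le_measure ?inE.
rewrite integral_mkcond; apply: integral_le_mul_measure => // p.
  by move=> /[dup] Ap [_ /fphi/andP[_ ?]]; rewrite patchE mem_set// lee_fin.
by move=> Ap; rewrite patchE memNset.
Qed.

Lemma distribution_outside_cube : P (X @^-1` ~` unit_cube) = 0%E.
Proof.
have := Xf (measurableC (@measurable_unit_cube R d)).
by rewrite setICl integral_set0.
Qed.

Lemma integral_le_inv_sup_dist (b : point) (h : point -> \bar R) (K : R) (J : nat) :
  (1 < d)%N -> 0 <= phi -> 0 <= K -> 1 <= K * J%:R -> (forall a, h a <= 1)%E ->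
  (forall a, (0 < sup_dist a b)%R -> h a <= (K / sup_dist a b)%:E)%E ->
  (\int[distribution P X]_a h a <= (K * (1 + 2 ^+ d.+1 * phi))%:E)%E.
Proof.
move=> d1 phi0 K0 KJ h1 hK.
apply: (@le_trans _ _ (K * (1 + \sum_(0 <= i < J) phi * 2 ^+ d * harmonic i ^+ 2))%:E).
  apply: (integral_layer_le (D := setT) (w := fun a => sup_dist a b)) => //.
  - exact: measurable_sup_dist.
  - by move=> a nTa; case: (nTa I).
  - exact: probability_le1.
  move=> i; rewrite setTI.
  apply: (le_trans (distribution_le_lebesgue phi0 (measurable_sup_ball _ _))).
  rewrite [X in (_ * X)%E](lebesgue_sup_ball b (harmonic_ge0 i)) -EFinM lee_fin -mulrA.
  rewrite ler_wpM2l// exprMn ler_wpM2l ?exprn_ge0// ler_wiXn2l ?harmonic_ge0//.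
  by rewrite /= invf_le1// ler1n.
rewrite lee_fin ler_wpM2l// lerD2l -mulr_sumr.
rewrite (_ : 2 ^+ d.+1 * phi = phi * 2 ^+ d * 2); last by rewrite exprS; ring.
by rewrite ler_wpM2l ?mulr_ge0 ?exprn_ge0//; exact: series_inv_sqr_le2.
Qed.

End bounded_density.

Section two_change_gain.
Context {R : realType} {d : nat}.
Local Notation point := (Rpoint R d).

Definition two_change_gain (u1 u2 v1 v2 : point) : R :=
  dist2 u1 u2 + dist2 v1 v2 - dist2 u1 v1 - dist2 u2 v2.

(* The points are v1, u2, u1, v2: for fixed v1 and u2 the gain is a difference of
   two values of |x - u2| - |x - v1|. *)
Definition small_gain (eps : R) : set (point * (point * (point * point))) :=
  [set z | [/\ unit_cube z.1, unit_cube z.2.1, unit_cube z.2.2.1, unit_cube z.2.2.2 &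
    `|two_change_gain z.2.2.1 z.2.1 z.1 z.2.2.2| <= eps]].

Lemma measurable_small_gain eps : measurable (small_gain eps).
Proof.
pose T := (point * (point * (point * point)))%type.
have mv1 : measurable_fun setT (fun z : T => z.1) by exact: measurable_fst.
have msnd : measurable_fun setT (fun z : T => z.2) by exact: measurable_snd.
have mu2 : measurable_fun setT (fun z : T => z.2.1) by exact: measurableT_comp msnd.
have mu1v2 : measurable_fun setT (fun z : T => z.2.2) by exact: measurableT_comp msnd.
have mu1 : measurable_fun setT (fun z : T => z.2.2.1) by exact: measurableT_comp mu1v2.
have mv2 : measurable_fun setT (fun z : T => z.2.2.2) by exact: measurableT_comp mu1v2.
rewrite (_ : small_gain eps = [set z : T | unit_cube z.1] `&` [set z | unit_cube z.2.1]
  `&` [set z | unit_cube z.2.2.1] `&` [set z | unit_cube z.2.2.2]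
  `&` [set z | `|two_change_gain z.2.2.1 z.2.1 z.1 z.2.2.2| <= eps]); last first.
  by apply/seteqP; split => [z []//|z [[[[]]]]].
apply: measurable_fun_le; last exact: measurable_cst.
  by repeat apply: measurableI; exact: measurable_preimage_unit_cube.
apply: measurable_funTS; apply: measurableT_comp => //.
apply: measurable_funB; last exact: measurable_dist2.
by apply: measurable_funB; [apply: measurable_funD|]; exact: measurable_dist2.
Qed.

Lemma small_gain_pair_level eps (b a : point) (z : point * point) :
  small_gain eps (b, (a, z)) -> [/\ unit_cube a, unit_cube b & pair_level a b eps z].
Proof.
move=> [/= cb ca cx cc gain_le]; split => //; split => //.
suff -> : dist2 z.1 a - dist2 z.1 b - (dist2 z.2 a - dist2 z.2 b) =
  two_change_gain z.1 a b z.2 by [].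
by rewrite /two_change_gain (dist2C z.2 a) (dist2C z.2 b); ring.
Qed.

End two_change_gain.

Section small_gain_probability.
Context {R : realType}.

Definition gain_const (d : nat) : R :=
  pair_level_const d * (1 + 2 ^+ d.+1).

Lemma gain_const_ge0 d : (0 < d)%N -> 0 <= gain_const d.
Proof.
move=> d0; rewrite mulr_ge0 ?addr_ge0 ?exprn_ge0//.
exact: le_trans (pair_level_const_ge1 d0).
Qed.

Context {n d : nat} {disp : measure_display} {Omega : measurableType disp}
  (P : probability Omega R).
Local Notation point := (Rpoint R d).
Variables (phi : R) (f : 'I_n -> point -> R) (X : 'I_n -> {RV P >-> point}).
Hypotheses (d_gt1 : (1 < d)%N) (phi_ge1 : 1 <= phi) (pX : perturbed_instance phi f X).

Let phi_ge0 : 0 <= phi. Proof. exact: le_trans phi_ge1. Qed.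

Lemma distribution_small_gain_le (k l : 'I_n) (eps : R) (J : nat) (a b : point) :
  0 < eps -> 1 <= eps * J%:R -> 0 < sup_dist a b ->
  ((distribution P (X k) \x distribution P (X l))
     (xsection (xsection (small_gain eps) b) a) <=
   (phi ^+ 2 * (pair_level_const d * (eps * (1 + series harmonic J)))
     / sup_dist a b)%:E)%E.
Proof.
move=> eps0 epsJ ab0; have [_ fphi fX _] := pX; set S := xsection _ a.
have mS : measurable S.
  by do 2!apply: measurable_xsection; exact: measurable_small_gain.
have S_level y : S y -> [/\ unit_cube a, unit_cube b & pair_level a b eps y].
  by rewrite /S /xsection/= !inE/= inE => /small_gain_pair_level.
have [->|/set0P[z /S_level[ca cb _]]] := eqVneq S set0.
  have const_ge0 := le_trans ler01 (pair_level_const_ge1 (ltnW d_gt1)).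
  rewrite measure0 lee_fin divr_ge0 ?(ltW ab0)// !mulr_ge0 ?exprn_ge0 ?(ltW eps0)//.
  by rewrite addr_ge0// series_harmonic_ge0.
apply: (le_trans (product_measure_le (k := NngNum phi_ge0) _ _ mS)).
- by move=> A mA; apply: distribution_le_lebesgue (fphi k) (fX k) _ _ mA.
- by move=> A mA; apply: distribution_le_lebesgue (fphi l) (fX l) _ _ mA.
rewrite /= -[X in (_ <= X%:E)%E]mulrA [leRHS]EFinM.
rewrite lee_wpmul2l ?lee_fin ?exprn_ge0 ?phi_ge0//.
apply: le_trans (lebesgue_pair_level_le d_gt1 ca cb ab0 eps0 epsJ).
apply: le_measure; rewrite ?inE//; first exact: measurable_pair_level.
by move=> y /S_level[].
Qed.

Lemma small_gain_probability_le (i j k l : 'I_n) (eps : R) (J : nat) :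
  uniq [:: i; j; k; l] -> 0 < eps -> 1 <= eps * J%:R ->
  (P [set w | small_gain eps (X i w, (X j w, (X k w, X l w)))] <=
   (gain_const d * phi ^+ 3 * (eps * (1 + series harmonic J)))%:E)%E.
Proof.
move=> uX eps0 epsJ; have [_ fphi fX indX] := pX.
rewrite (joint_law4 indX uX (measurable_small_gain eps)).
set K := phi ^+ 2 * (pair_level_const d * (eps * (1 + series harmonic J))).
have eps_le : eps <= K.
  rewrite (_ : K = phi ^+ 2 * pair_level_const d * (1 + series harmonic J) * eps);
    last by rewrite /K; ring.
  rewrite ler_peMl ?(ltW eps0)//; apply: mulr_ege1; last first.
    by rewrite lerDl series_harmonic_ge0.
  by rewrite mulr_ege1 ?exprn_ege1// pair_level_const_ge1// ltnW.
have K0 : 0 <= K := le_trans (ltW eps0) eps_le.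
apply: (@le_trans _ _ (K * (1 + 2 ^+ d.+1 * phi))%:E); last first.
  rewrite lee_fin (_ : gain_const d * _ * _ = K * (phi * (1 + 2 ^+ d.+1))); last first.
    by rewrite /K /gain_const; ring.
  by rewrite ler_wpM2l// mulrDr mulr1 [phi * _]mulrC lerD2r.
apply: integral_probability_le => [|b].
  by rewrite lee_fin mulr_ge0// addr_ge0// mulr_ge0// exprn_ge0.
apply: (integral_le_inv_sup_dist (fphi j) (fX j) (J := J)) => //.
- by apply: (le_trans epsJ); rewrite ler_wpM2r.
- move=> a; pose law_kl : probability (point * point)%type R :=
    (distribution P (X k) \x distribution P (X l))%E.
  apply: (probability_le1 law_kl).
  by do 2!apply: measurable_xsection; exact: measurable_small_gain.
- by move=> a; exact: distribution_small_gain_le.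
Qed.

End small_gain_probability.

(** * Tours *)

Lemma sum_exchange (V : zmodType) (T : finType) (E S S' : {set T}) (F : T -> V) :
  S \subset E -> #|S| = #|S'| -> #|E :\: S :|: S'| = #|E| ->
  \sum_(e in E) F e - \sum_(e in E :\: S :|: S') F e =
  \sum_(e in S) F e - \sum_(e in S') F e.
Proof.
move=> SE SS' cardE'.
have disjS' : fintype.disjoint (mem (E :\: S)%SET) (mem S').
  have [_ <-] := finset.leq_card_setU (E :\: S)%SET S'.
  by rewrite cardE' -SS' cardsD (finset.setIidPr SE) subnK// subset_leq_card.
rewrite (big_setID S)/= (finset.setIidPr SE).
rewrite [X in _ - X](eq_bigl [predU (E :\: S)%SET & S']) => [|e]; last by rewrite !inE.
by rewrite bigU//= addrKA.
Qed.

Section tours.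
Context {R : realType} {n d : nat}.
Implicit Types (t : @tour n) (x : 'I_n -> Rpoint R d).

Lemma mem_tour t u : u \in tour_tuple t.
Proof.
have := uniq_min_size (tour_uniq t) (s2 := enum 'I_n).
rewrite -cardE card_ord [X in (_ <= X)%N]size_tuple leqnn.
by move=> /(_ _ isT)[v|_ ->]; rewrite mem_enum.
Qed.

Lemma next_order t u : fingraph.order (next t) u = n.
Proof.
have := order_cycle (cycle_next (tour_uniq t)) (tour_uniq t) (mem_tour t u).
by rewrite size_tuple.
Qed.

Lemma next_next_neq t u : (2 < n)%N -> next t (next t u) != u.
Proof.
move=> n2; have := orbit_uniq (next t) u; rewrite /orbit next_order.
case: n n2 t u => [|[|[|m]]]// _ t u /=.
by rewrite !inE !negb_or => /andP[/and3P[_ next2_neq _] _]; rewrite eq_sym.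
Qed.

Lemma edge_inj t : (2 < n)%N -> injective (fun u => [set u; next t u]%SET).
Proof.
move=> n2 u v uv.
have : u \in [set v; next t v]%SET by rewrite -uv !inE eqxx.
have : v \in [set u; next t u]%SET by rewrite uv !inE eqxx.
rewrite !inE => /orP[/eqP//|/eqP vu] /orP[/eqP//|/eqP uv'].
by have := next_next_neq t u n2; rewrite -vu -uv' eqxx.
Qed.

Lemma card_tour_edges t : (2 < n)%N -> #|tour_edges t| = n.
Proof. by move=> n2; rewrite card_imset ?card_ord//; exact: edge_inj. Qed.

Definition edge_length x (e : {set 'I_n}) : R :=
  (\sum_(u in e) \sum_(v in e) dist2 (x u) (x v)) / 2.

Lemma edge_length_set2 x u v : edge_length x [set u; v]%SET = dist2 (x u) (x v).
Proof.
rewrite /edge_length; have [->|uv] := eqVneq u v.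
  by rewrite finset.setUid !big_set1 dist2xx mul0r.
have sum2 (F : 'I_n -> R) : \sum_(w in [set u; v]%SET) F w = F u + F v.
  by rewrite big_setU1 ?inE//= big_set1.
by rewrite !sum2 !dist2xx add0r addr0 (dist2C (x v)); field.
Qed.

Lemma tour_length_edges x t : (2 < n)%N ->
  tour_length x t = \sum_(e in tour_edges t) edge_length x e.
Proof.
move=> n2; rewrite /tour_edges big_imset/=; last by move=> u v _ _; exact: edge_inj.
by apply: eq_big => // u _; rewrite edge_length_set2.
Qed.

Local Notation quad := ('I_n * 'I_n * 'I_n * 'I_n)%type.

Definition distinct4 (q : quad) : bool :=
  let: (u1, u2, v1, v2) := q in uniq [:: u1; u2; v1; v2].

Definition quad_gain x (q : quad) : R :=
  let: (u1, u2, v1, v2) := q in two_change_gain (x u1) (x u2) (x v1) (x v2).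

Lemma two_change_quad_gain x t t' : two_change t t' ->
  exists2 q, distinct4 q & tour_length x t - tour_length x t' = quad_gain x q.
Proof.
case/existsP => u1 /existsP[u2 /existsP[v1 /existsP[v2]]].
case/and4P => uq /eqP nu /eqP nv /eqP edgesE.
exists (u1, u2, v1, v2) => //.
have n2 : (2 < n)%N.
  rewrite -(card_ord n); apply: leq_trans (max_card (mem [:: u1; u2; v1; v2])).
  by rewrite (card_uniqP uq).
move: (uq); rewrite /= !inE !negb_or -!andbA andbT.
case/and5P => u12 u1v1 u1v2 u2v1 /andP[u2v2 v12].
have old_neq : [set u1; u2]%SET != [set v1; v2]%SET.
  by apply/eqP => /setP/(_ u1); rewrite !inE eqxx (negbTE u1v1) (negbTE u1v2).
have new_neq : [set u1; v1]%SET != [set u2; v2]%SET.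
  by apply/eqP => /setP/(_ u1); rewrite !inE eqxx (negbTE u12) (negbTE u1v2).
have sum2 (e e' : {set 'I_n}) : e != e' ->
    \sum_(s in [set e; e']%SET) edge_length x s = edge_length x e + edge_length x e'.
  by move=> ee'; rewrite big_setU1 ?inE//= big_set1.
rewrite !tour_length_edges// edgesE sum_exchange.
- by rewrite !sum2// !edge_length_set2 /quad_gain /two_change_gain; ring.
- apply/fintype.subsetP => e; rewrite !inE => /orP[]/eqP->; apply/imsetP.
    by exists u1 => //; rewrite nu.
  by exists v1 => //; rewrite nv.
- by rewrite !cards2 old_neq new_neq.
- by rewrite -edgesE !card_tour_edges.
Qed.

Lemma tour_length_ge0 x t : 0 <= tour_length x t.
Proof. by apply: sumr_ge0 => u _; exact: dist2_ge0. Qed.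

Lemma tour_length_unit_cube x t : (forall i, unit_cube (x i)) ->
  tour_length x t <= n%:R * Num.sqrt d%:R.
Proof.
move=> cx; rewrite mulr_natl -[X in _ *+ X]card_ord -sumr_const.
by apply: ler_sum => u _; exact: dist2_unit_cube.
Qed.

Lemma path_improvement_lt x (delta : R) t (r : seq tour) :
  (forall s s', improving x s s' -> delta < tour_length x s - tour_length x s') ->
  path (improving x) t r -> (0 < size r)%N ->
  delta * (size r)%:R < tour_length x t - tour_length x (last t r).
Proof.
move=> large_step; elim: r t => // s [|s' r] IH t.
  by rewrite /= andbT mulr1 => /large_step.
move=> /= /andP[/large_step ts sr] _; have := IH s sr isT.
by rewrite /= -[X in _ -> delta * X < _]natr1 mulrDr mulr1; lra.
Qed.

Lemma size_improving_path x t (r : seq tour) :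
  path (improving x) t r -> (size r <= n ^ n)%N.
Proof.
move=> tr; pose len (s : n.-tuple 'I_n) : R := \sum_(u < n) dist2 (x u) (x (next s u)).
have ulen : uniq (map len (map (@tour_tuple n) r)).
  apply: (@sorted_uniq _ (fun a b => b < a)).
  - by move=> a b c ba cb; exact: lt_trans ba.
  - by move=> a; exact: ltxx.
  apply: (@path_sorted _ _ (tour_length x t)); rewrite -map_comp path_map.
  by apply: sub_path tr => s s' /andP[].
rewrite -(size_map (@tour_tuple n)) -(card_uniqP (map_uniq ulen)).
by apply: leq_trans (max_card _) _; rewrite card_tuple card_ord.
Qed.

End tours.

(** * Expected number of steps *)

Section step_count.
Context {R : realType} {n d : nat}.
Local Notation quad := ('I_n * 'I_n * 'I_n * 'I_n)%type.
Local Notation L := (n%:R * Num.sqrt d%:R : R).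
Implicit Type x : 'I_n -> Rpoint R d.

(* A run of m steps starts at length at most L, so for every k < m some step gains
   at most L / k.+1. *)
Lemma size_improving_path_le_small_gains x t r :
  (forall i, unit_cube (x i)) -> path (improving x) t r ->
  (size r <= \sum_(p : 'I_(n ^ n) * quad | distinct4 p.2)
     (`|quad_gain x p.2| <= L * harmonic p.1)%R)%N.
Proof.
move=> cx tr.
rewrite -(pair_big xpredT distinct4
  (fun (k : 'I_(n ^ n)) q => (`|quad_gain x q| <= L * harmonic k)%R : nat))/=.
rewrite -(big_mkord xpredT
  (fun k => \sum_(q | distinct4 q) (`|quad_gain x q| <= L * harmonic k)%R))%N.
rewrite -[leqLHS]addn0 (big_cat_nat _ (n := size r)) ?(size_improving_path tr)//=.
apply: leq_add => //; rewrite -[leqLHS]subn0 -[leqLHS]muln1 -sum_nat_const_nat.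
rewrite big_nat [leqRHS]big_nat; apply: leq_sum => k /andP[_ kr].
have [/existsP[q /andP[qd qk]]|] := boolP [exists q : quad,
    distinct4 q && (`|quad_gain x q| <= L * harmonic k)].
  by rewrite (bigD1 q)//= qk.
rewrite negb_exists => /forallP no_small_gain; exfalso.
have large_gain s s' : improving x s s' ->
    L * harmonic k < tour_length x s - tour_length x s'.
  move=> /andP[/(two_change_quad_gain x)[q qd gainE] lt]; have := no_small_gain q.
  by rewrite qd /= -ltNge -gainE gtr0_norm ?subr_gt0.
have := path_improvement_lt large_gain tr (leq_ltn_trans (leq0n k) kr).
apply/negP; rewrite -leNgt; apply: (@le_trans _ _ L).
  by have := tour_length_unit_cube t cx; have := tour_length_ge0 x (last t r); lra.
by rewrite -mulrA ler_peMr ?mulr_ge0 ?sqrtr_ge0// mulrC ler_pdivlMr// mul1r ler_nat.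
Qed.

End step_count.

Section expectation.
Context {R : realType} {n d : nat} {disp : measure_display}
  {Omega : measurableType disp} (P : probability Omega R).
Local Notation point := (Rpoint R d).
Local Notation quad := ('I_n * 'I_n * 'I_n * 'I_n)%type.
Variables (phi : R) (f : 'I_n -> point -> R) (X : 'I_n -> {RV P >-> point}).
Hypotheses (d_gt1 : (1 < d)%N) (n_gt0 : (0 < n)%N) (phi_ge1 : 1 <= phi).
Hypothesis pX : perturbed_instance phi f X.

Definition small_gain_event (eps : R) (q : quad) : set Omega :=
  let: (u1, u2, v1, v2) := q in
  [set w | small_gain eps (X v1 w, (X u2 w, (X u1 w, X v2 w)))].

Lemma measurable_small_gain_event eps q : measurable (small_gain_event eps q).
Proof.
move: q => [[[u1 u2] v1] v2].
have mX u : measurable_fun setT (X u) by exact: measurable_funP.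
apply: (measurable_preimageT (f := fun w => (X v1 w, (X u2 w, (X u1 w, X v2 w))))).
  by repeat apply: measurable_fun_pair.
exact: measurable_small_gain.
Qed.

Lemma ae_unit_cube : {ae P, forall w, forall i, unit_cube (X i w)}.
Proof.
apply: filter_forall => i; have [_ _ fX _] := pX.
exists (X i @^-1` ~` unit_cube); split=> //; last first.
  exact: distribution_outside_cube (fX i).
by apply: measurable_funPTI; apply: measurableC; exact: measurable_unit_cube.
Qed.

Local Notation L := (n%:R * Num.sqrt d%:R : R).

Lemma two_opt_steps_le_small_gains w : (forall i, unit_cube (X i w)) ->
  (two_opt_steps (fun i => X i w) <=
   \sum_(p : 'I_(n ^ n) * quad | distinct4 p.2)
     (\1_(small_gain_event (L * harmonic p.1) p.2) w)%:E)%E.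
Proof.
move=> cw; apply: ge_ereal_sup => _ [t [r [[tr _] ->]]].
have := size_improving_path_le_small_gains cw tr.
rewrite -(ler_nat R) -lee_fin => /le_trans; apply.
rewrite natr_sum -sumEFin; apply: lee_sum => -[k q] _; rewrite lee_fin indicE ler_nat.
have [gq|//] := boolP (_ <= _); rewrite mem_set//.
by move: q gq => [[[u1 u2] v1] v2] gq; split => //=; exact: cw.
Qed.

Lemma expected_two_opt_steps_le_small_gains :
  (\int[P]_w two_opt_steps (fun i => X i w) <=
   \sum_(p : 'I_(n ^ n) * quad | distinct4 p.2)
     P (small_gain_event (L * harmonic p.1) p.2))%E.
Proof.
apply: ae_integral_le_sum_measure => [p|]; first exact: measurable_small_gain_event.
by move: ae_unit_cube; apply: filterS => w; exact: two_opt_steps_le_small_gains.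
Qed.

Lemma expected_two_opt_steps_lt4 : (n < 4)%N ->
  (\int[P]_w two_opt_steps (fun i => X i w) <= 0)%E.
Proof.
move=> n4; apply: (le_trans expected_two_opt_steps_le_small_gains).
rewrite big1// => -[k [[[u1 u2] v1] v2]] /card_uniqP uq.
have := max_card (mem [:: u1; u2; v1; v2]).
by rewrite uq card_ord leqNgt n4.
Qed.

Lemma small_gain_event_probability_le k q : (k < n ^ n)%N -> distinct4 q ->
  (P (small_gain_event (L * harmonic k) q) <=
   (gain_const d * phi ^+ 3 * (L * harmonic k * (1 + series harmonic (n ^ n)%N)))%:E)%E.
Proof.
move: q => [[[u1 u2] v1] v2] kn dq.
have L_ge1 : 1 <= L by rewrite mulr_ege1 ?ler1n// sqrt_natr_ge1 1?ltnW.
apply: (small_gain_probability_le d_gt1 phi_ge1 pX).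
- by rewrite (@perm_uniq _ _ [:: u1; u2; v1; v2])//; apply/permP => p /=; lia.
- by rewrite mulr_gt0 ?harmonic_gt0// (lt_le_trans _ L_ge1).
- rewrite -mulrA mulr_ege1// mulrC ler_pdivlMr// mul1r ler_nat; exact: kn.
Qed.

Lemma expected_two_opt_steps_le :
  (\int[P]_w two_opt_steps (fun i => X i w) <=
   (gain_const d * phi ^+ 3 * n%:R ^+ 4 * L *
     (series harmonic (n ^ n)%N * (1 + series harmonic (n ^ n)%N)))%:E)%E.
Proof.
set H : R := series harmonic _.
pose bound (k : nat) : R := gain_const d * phi ^+ 3 * (L * harmonic k * (1 + H)).
apply: (le_trans expected_two_opt_steps_le_small_gains).
apply: (@le_trans _ _
    (\sum_(p : 'I_(n ^ n) * quad | distinct4 p.2) (bound p.1)%:E)%E).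
  by apply: lee_sum => p; exact: small_gain_event_probability_le.
rewrite -(pair_big xpredT distinct4 (fun (k : 'I_(n ^ n)) _ => (bound k)%:E))/=.
apply: (@le_trans _ _ (\sum_(k < n ^ n) (bound k * n%:R ^+ 4)%:E)%E).
  apply: lee_sum => k _; rewrite sumEFin sumr_const lee_fin -[leLHS]mulr_natr.
  have bound_ge0 : 0 <= bound k.
    have phi_ge0 : 0 <= phi by exact: le_trans phi_ge1.
    have const_ge0 : 0 <= gain_const d :> R by exact/gain_const_ge0/ltnW.
    rewrite !mulr_ge0 ?exprn_ge0 ?sqrtr_ge0 ?harmonic_ge0//.
    by rewrite addr_ge0// series_harmonic_ge0.
  rewrite ler_wpM2l// -natrX ler_nat; apply: leq_trans (max_card _) _.
  by rewrite !card_prod card_ord !expnS expn0 muln1 !mulnA.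
rewrite sumEFin lee_fin -mulr_suml le_eqVlt; apply/orP; left; apply/eqP.
have HE : H = \sum_(k < n ^ n) harmonic k by rewrite /H /series/= big_mkord.
by rewrite /bound -mulr_sumr -mulr_suml -mulr_sumr -HE; ring.
Qed.

End expectation.

Lemma series_harmonic_selfpower_le (R : realType) (n : nat) : (1 < n)%N ->
  series harmonic (n ^ n)%N * (1 + series harmonic (n ^ n)%N) <=
  6 * (n%:R * ln n%:R) ^+ 2 :> R.
Proof.
move=> n1; set H := series harmonic _; set l := n%:R * ln n%:R.
have n2 : 2 <= n%:R :> R by rewrite (ler_nat _ 2).
have n0 : 0 < n%:R :> R by lra.
have l1 : 1 <= l.
  have : 1 - n%:R^-1 <= ln n%:R :> R.
    rewrite -[X in _ <= ln X]invrK lnV ?posrE ?invr_gt0// lerNr opprB.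
    by rewrite -[X in ln X](subrKC 1) le_ln1Dx// ltrBrDl subrr invr_gt0.
  move=> /(ler_wpM2l (ltW n0)); apply: le_trans.
  by rewrite mulrBr mulr1 divff ?gt_eqF//; lra.
have H_le : H <= 1 + l.
  rewrite /l mulr_natl -lnXn// -natrX; apply: series_harmonic_le_ln.
  by rewrite expn_gt0 ltnW.
have H_ge0 : 0 <= H by exact: series_harmonic_ge0.
have -> : 6 * l ^+ 2 = (2 * l) * (3 * l) by ring.
by apply: ler_pM; lra.
Qed.

Theorem theorem6 (R : realType) (d : nat) (hd : (2 <= d)%N) :
  exists C : R, forall (n : nat) (phi : R), (0 < n)%N -> 1 <= phi ->
    forall (disp : measure_display) (Omega : measurableType disp)
      (P : probability Omega R)
      (f : 'I_n -> Rpoint R d -> R) (X : 'I_n -> {RV P >-> Rpoint R d}),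
    perturbed_instance phi f X ->
    (\int[P]_w two_opt_steps (fun i => X i w)
       <= (C * n%:R ^+ 7 * ln n%:R ^+ 2 * phi ^+ 3)%:E)%E.
Proof.
exists (6 * gain_const d * Num.sqrt d%:R) => n phi n0 phi1 disp Omega P f X pX.
have phi0 : 0 <= phi by exact: le_trans phi1.
have gain_ge0 : 0 <= gain_const d :> R by exact/gain_const_ge0/ltnW.
have [n4|n4] := ltnP n 4.
  apply: (le_trans (expected_two_opt_steps_lt4 pX n4)); rewrite lee_fin.
  by rewrite !mulr_ge0 ?exprn_ge0 ?sqrtr_ge0 ?ln_ge0 ?ler1n.
apply: (le_trans (expected_two_opt_steps_le hd n0 phi1 pX)); rewrite lee_fin.
have -> : 6 * gain_const d * Num.sqrt d%:R * n%:R ^+ 7 * ln n%:R ^+ 2 * phi ^+ 3 =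
    gain_const d * phi ^+ 3 * n%:R ^+ 4 * (n%:R * Num.sqrt d%:R) *
    (6 * (n%:R * ln n%:R) ^+ 2) by ring.
rewrite ler_wpM2l ?series_harmonic_selfpower_le//; last exact: leq_trans n4.
by rewrite !mulr_ge0 ?exprn_ge0 ?sqrtr_ge0.
Qed.
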